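(* Let $T$ be a symmetric subset of $\mathbb Z\times\mathbb Z$ (i.e. $(n,m)\in T$ for all $(m,n)\in T$) containing the diagonal $\{(n,n)\colon n\in\mathbb Z\}$, and let $Z\subset\mathbb C_*$ be a determining set for $\mathbb C[z,\bar z]$. Then for any system of complex numbers $\{c_{m,n}\}_{(m,n)\in T}$, the following conditions are equivalent: (i) there exists a positive Borel measure $\mu$ on $\mathbb C_*$ such that $c_{m,n}=\int_{\mathbb C_*}z^m\bar z^n\,\mu(dz)$ for all $(m,n)\in T$; (ii) $\sum_{(m,n)\in T}p_{m,n}c_{m,n}\ge0$ for every finite system $\{p_{m,n}\}_{(m,n)\in T}\subset\mathbb C$ such that $\sum_{(m,n)\in T}p_{m,n}z^m\bar z^n\ge0$ for all $z\in\mathbb C_*$; (iii) $\sum_{(m,n)\in T}p_{m,n}c_{m,n}\ge0$ for every finite system $\{p_{m,n}\}_{(m,n)\in T}\subset\mathbb C$ for which there exist finitely many rational functions $q_1,\dots,q_k\in\mathbb C_{\mathfrak Z}(z,\bar z)$ such that $\sum_{(m,n)\in T}p_{m,n}z^m\bar z^n=\sum_{j=1}^k|q_j(z,\bar z)|^2$ for all $z\in Z$.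
   Context: $\mathbb C_*=\mathbb C\setminus\{0\}$. A system of complex numbers is finite if only finitely many members are nonzero. $\mathbb C[z,\bar z]$ is the ring of all complex polynomials in $z$ and $\bar z$; a set $Z\subset\mathbb C$ is determining for $\mathbb C[z,\bar z]$ if every $p\in\mathbb C[z,\bar z]$ with $p(z,\bar z)=0$ for all $z\in Z$ vanishes identically. $\mathbb C_{\mathfrak Z}(z,\bar z)$ is the set of all functions on $\mathbb C_*$ of the form $z\mapsto\sum_{m,n\in\mathbb Z}a_{m,n}z^m\bar z^n$ with $\{a_{m,n}\}$ a finite system of complex numbers. All integrands are tacitly assumed to be summable. *)

(* Defs.v *)
From HB Require Import structures.
From mathcomp Require Import all_boot all_order all_algebra.
From mathcomp Require Import all_classical all_reals all_analysis.
From mathcomp Require Import complex.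

Set Implicit Arguments.
Unset Strict Implicit.
Unset Printing Implicit Defensive.

Import Order.TTheory GRing.Theory Num.Theory.

Local Open Scope classical_set_scope.
Local Open Scope ring_scope.

(* The topology of R[i] is the one of its norm; the library only puts it on the
   alias R[i]^o. *)
Definition Cstar (R : realType) : Type := set_type [set z : R[i]^o | z != 0].

HB.instance Definition _ (R : realType) := Topological.on (Cstar R).

Lemma Cstar1_subproof (R : realType) : (1 : R[i]^o) \in [set z : R[i]^o | z != 0].
Proof. by rewrite inE /= oner_neq0. Qed.

HB.instance Definition _ (R : realType) :=
  isPointed.Build (Cstar R) (exist _ 1 (Cstar1_subproof R)).

Definition Cval (R : realType) (z : Cstar R) : R[i] := \val z.

Definition Cstar_borel (R : realType) := g_sigma_algebraType (@open (Cstar R)).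

Definition monom (R : realType) (k : int * int) (z : Cstar R) : R[i] :=
  Cval z ^ k.1 * (Cval z)^* ^ k.2.

Section complex_integral.
Context d (X : measurableType d) (R : realType).
Variables (mu : {measure set X -> \bar R}) (f : X -> R[i]).

Definition cintegrable : Prop :=
  mu.-integrable setT (EFin \o (fun x => complex.Re (f x))) /\
  mu.-integrable setT (EFin \o (fun x => complex.Im (f x))).

Definition cintegral : R[i] :=
  Complex (\int[mu]_x complex.Re (f x)) (\int[mu]_x complex.Im (f x)).

End complex_integral.

(* A system indexed by T is given by a function on the whole index type; its
   values outside of T are irrelevant. *)
Definition finite_system (V : nmodType) (I : Type) (T : set I) (p : I -> V) :
  Prop := finite_set (T `&` [set k | p k != 0]).

Definition laurent_sum (R : realType) (T : set (int * int))
    (p : int * int -> R[i]) (z : Cstar R) : R[i] :=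
  \sum_(k \in T) p k * monom k z.

Definition laurent_fun (R : realType) : set (Cstar R -> R[i]) :=
  [set q | exists2 a : int * int -> R[i],
             finite_system setT a & q = laurent_sum setT a].

(* The outer variable of p stands for z and the inner one for its conjugate. *)
Definition determining (R : realType) (Z : set R[i]) : Prop :=
  forall p : {poly {poly R[i]}},
    (forall z, Z z -> p.[z%:P].[z^*] = 0) -> forall z, p.[z%:P].[z^*] = 0.

(* Main.v *)
Require Import Defs.
From HB Require Import structures.
From mathcomp Require Import all_boot all_order all_algebra.
From mathcomp Require Import all_classical all_reals all_analysis.
From mathcomp Require Import complex measurable_realfun ring lra zify.

(* The conditions are linked through the cone of sums of squares and through a
   Riesz-Haviland theorem on the punctured plane.

   (iii) => (ii).  In polar coordinates [z = x u] with [x] real and [|u| = 1], a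
   nonnegative Laurent polynomial [f] restricts on each line [u = v] to a
   nonnegative Laurent polynomial in [x], which is a squared modulus once [f] is
   made strictly positive.  The Fejer kernel in [u] is itself a squared modulus,
   so the Fejer means of [f], written as averages over roots of unity [v], are
   sums of squares with the same monomials as [f].  The small error is absorbed
   by diagonal monomials [|z|^(2n)], whose indices belong to [T]; these are then
   multiplied by a constant tending to [0].

   (ii) => (iii).  An identity between Laurent polynomials on [Z] holds
   everywhere, after multiplication by a power of [|z|^2].

   (ii) => (i).  By the Hahn-Banach theorem the functional [p |-> sum p c] gives a
   positive functional on all bounded functions, that is, a finitely additive
   measure on the punctured plane.  The plane is parametrized by a digit curve
   [R -> C_*] which maps the cells of a 6-adic subdivision to small sets and has
   a section avoiding neighbourhoods of the end points of the cells.  The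
   finitely additive measure of the half lines, pulled back along the section,
   is a monotone function; its Stieltjes measure agrees with the finitely
   additive one on cells, and its image under the curve represents [c], since
   every Laurent polynomial is approximated by step functions on cells up to a
   multiple of [|z|^(2N) + |z|^(-2N)]. *)

Set Implicit Arguments.
Unset Strict Implicit.
Unset Printing Implicit Defensive.

Import Order.TTheory GRing.Theory Num.Theory.

Local Open Scope classical_set_scope.
Local Open Scope ring_scope.

(** * Finite systems *)

Section finite_systems.
Context (F : fieldType) (I : choiceType) (T : set I).
Implicit Types (p : I -> F) (k : I).

(** One sequence of indices serves for every [g], so that the values at [z] and the values of the
    functional are summed over the same [s]. *)
Lemma finite_system_seq p : finite_system T p ->
  exists s : seq I, [/\ uniq s, (forall k, k \in s -> T k) &
    forall g : I -> F, \sum_(k \in T) p k * g k = \sum_(k <- s) p k * g k].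
Proof.
move=> fp; exists (finmap.enum_fset (fset_set (T `&` [set k | p k != 0]))); split.
- exact: finmap.fset_uniq.
- by move=> k; rewrite in_fset_set// inE => -[].
- move=> g; rewrite -fsbig_finite//; apply/esym/fsbig_widen => [k []//|].
  by move=> k [Tk] /not_andP [//|/negP/negPn/eqP pk0] /=; rewrite pk0 mul0r.
Qed.

Lemma finite_systemD p1 p2 : finite_system T p1 -> finite_system T p2 ->
  finite_system T (fun k => p1 k + p2 k).
Proof.
move=> f1 f2; apply: (@sub_finite_set _ _ ((T `&` [set k | p1 k != 0]) `|`
    (T `&` [set k | p2 k != 0]))); last by rewrite finite_setU.
move=> k [Tk /= pk]; have [p10|p1N0] := eqVneq (p1 k) 0; last by left.
by right; split=> //=; move: pk; rewrite p10 add0r.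
Qed.

Lemma finite_systemZ a p : finite_system T p ->
  finite_system T (fun k => a * p k).
Proof.
apply: sub_finite_set => k [Tk /= pk]; split=> //=.
by apply: contraNneq pk => ->; rewrite mulr0.
Qed.

Lemma finite_system_fsum (D : choiceType) (s : seq D) (p : D -> I -> F) :
  (forall i, i \in s -> finite_system T (p i)) ->
  finite_system T (fun k => \sum_(i <- s) p i k).
Proof.
elim: s => [|i s IHs] fp.
  apply: sub_finite_set (finite_set0 _) => k [_ /=].
  by rewrite big_nil eqxx.
rewrite (_ : (fun k => _) = (fun k => p i k + \sum_(i <- s) p i k)); last first.
  by apply/funext => k; rewrite big_cons.
apply: finite_systemD; first by apply: fp; rewrite mem_head.
by apply: IHs => j js; apply: fp; rewrite inE js orbT.
Qed.

(** The three sums are moved to one finite set [S] that contains both supports, where finite sums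
    add. *)
Lemma fsumD p1 p2 (g : I -> F) : finite_system T p1 -> finite_system T p2 ->
  \sum_(k \in T) (p1 k + p2 k) * g k =
  \sum_(k \in T) p1 k * g k + \sum_(k \in T) p2 k * g k.
Proof.
move=> f1 f2; set S := (T `&` [set k | p1 k != 0]) `|`
    (T `&` [set k | p2 k != 0]).
have fS : finite_set S by rewrite finite_setU.
have widen p : (forall k, T k -> ~ S k -> p k = 0) ->
    \sum_(k \in T) p k * g k = \sum_(k \in S) p k * g k.
  move=> pS; apply/esym/fsbig_widen; first by move=> k [|] [].
  by move=> k [Tk Sk] /=; rewrite pS// mul0r.
have p10 k : T k -> ~ S k -> p1 k = 0.
  by move=> Tk Sk; apply/eqP/negPn/negP => pk; apply: Sk; left.
have p20 k : T k -> ~ S k -> p2 k = 0.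
  by move=> Tk Sk; apply/eqP/negPn/negP => pk; apply: Sk; right.
rewrite !widen// -?fsbig_split//; last first.
  by move=> k Tk Sk; rewrite p10// p20// addr0.
by apply: eq_fsbigr => k _; rewrite mulrDl.
Qed.

Lemma fsumZ a p (g : I -> F) :
  \sum_(k \in T) (a * p k) * g k = a * \sum_(k \in T) p k * g k.
Proof. by rewrite mulr_fsumr; apply: eq_fsbigr => k _; rewrite mulrA. Qed.

Lemma fsum_fsum (D : choiceType) (s : seq D) (p : D -> I -> F) (g : I -> F) :
  (forall i, i \in s -> finite_system T (p i)) ->
  \sum_(k \in T) (\sum_(i <- s) p i k) * g k =
  \sum_(i <- s) \sum_(k \in T) p i k * g k.
Proof.
elim: s => [|i s IHs] fp.
  by rewrite big_nil fsbig1// => k _; rewrite big_nil mul0r.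
rewrite big_cons -IHs => [|j js]; last by apply: fp; rewrite inE js orbT.
rewrite -fsumD; first by apply: eq_fsbigr => k _; rewrite big_cons.
  by apply: fp; rewrite mem_head.
by apply: finite_system_fsum => j js; apply: fp; rewrite inE js orbT.
Qed.

Definition single k a : I -> F := fun i => if i == k then a else 0.

Lemma finite_system_single k a : finite_system T (single k a).
Proof.
apply: sub_finite_set (finite_set1 k) => i [_ /=]; rewrite /single.
by case: (i =P k) => // _; rewrite eqxx.
Qed.

Lemma fsum_single k a (g : I -> F) : T k ->
  \sum_(i \in T) single k a i * g i = a * g k.
Proof.
move=> Tk; rewrite -(fsbig_widen [set k]) /single.
- by rewrite fsbig_set1 eqxx.
- by move=> i ->.
- by move=> i [_ /= /eqP/negPf->]; rewrite mul0r.
Qed.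

End finite_systems.

(** Nonnegative elements of [R[i]] are real, so the values [d = 1] and [d = 2] show that [a] and [b]
    are real; the rest is a limit [d -> 0] for real parts. *)
Lemma ge0_complex_lim (R : realType) (a b : R[i]) :
  (forall d : R, 0 < d -> 0 <= a + d%:C%C * b) -> 0 <= a.
Proof.
case: a b => ar ai [br bi] H.
have {}H (d : R) : 0 < d -> (ai + d * bi == 0) && (0 <= ar + d * br).
  by move=> d0; move: (H d d0); rewrite lecE /= !mul0r subr0 addr0.
have /andP[/eqP h1 _] := H 1 ltr01.
have /andP[/eqP h2 _] := H 2 (ltr0Sn _ 1).
rewrite lecE /=; apply/andP; split; first by apply/eqP; lra.
rewrite leNgt; apply/negP => ar0.
have [br0|br0] := lerP br 0.
  by have /andP[_] := H 1 ltr01; rewrite leNgt mul1r => /negP; apply; lra.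
(* This [d] makes the real part equal to [ar / 2], which is negative. *)
have /andP[_] := H (- ar / (2 * br)) ltac:(by rewrite divr_gt0//; lra).
have -> : - ar / (2 * br) * br = - ar / 2 by field; lra.
lra.
Qed.

(** * Univariate polynomials and roots of unity *)

Section univariate.
Context {R : realType}.

Lemma poly_nat_eq0 (C : numDomainType) (p : {poly C}) :
  (forall n : nat, p.[n%:R] = 0) -> p = 0.
Proof.
move=> p0; pose rs := [seq n%:R | n <- iota 0 (size p)] : seq C.
apply: (@roots_geq_poly_eq0 _ p rs); last by rewrite size_map size_iota.
  by apply/allP => _ /mapP[n _ ->]; apply/eqP/p0.
rewrite map_inj_uniq ?iota_uniq// => m n /eqP.
by rewrite eqr_nat => /eqP.
Qed.

(* Nonreal roots of a polynomial that is real on the line come in conjugate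
   pairs, and [(x - w)(x - w^* ) = |x - w|^2]. *)
Lemma poly_pos_normsq (P : {poly R[i]}) :
  (forall x : R, 0 < P.[x%:C%C]) ->
  exists h : {poly R[i]}, forall x : R, P.[x%:C%C] = `|h.[x%:C%C]| ^+ 2.
Proof.
have [n] := ubnP (size P); elim: n P => // n IHn P sP Ppos.
have [sP1|sP1] := eqVneq (size P) 1.
  have /eqP/size_poly1P[c c0 Pc] := sP1.
  have c_gt0 : 0 < c by move: (Ppos 0); rewrite Pc hornerC.
  exists (sqrtC c)%:P => x; rewrite Pc !hornerC ger0_norm ?sqrtC_ge0 ?ltW//.
  by rewrite sqrtCK.
have /closed_rootP[w /rootP Pw] := sP1.
(* [P] and its conjugate agree at all natural numbers, hence are equal: the coefficients are
   real. *)
have PJ : map_poly Num.conj P = P.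
  apply/eqP; rewrite -subr_eq0; apply/eqP/poly_nat_eq0 => k.
  have kE : (k%:R : R[i]) = (k%:R : R)%:C%C by rewrite rmorph_nat.
  have kJ : (k%:R : R[i])^* = k%:R by rewrite rmorph_nat.
  rewrite hornerD hornerN -{1}kJ horner_map; apply/eqP; rewrite subr_eq0.
  apply/eqP/CrealP.
  by rewrite kE; apply/ger0_real/ltW/Ppos.
have PwJ : P.[w^*] = 0 by rewrite -PJ horner_map Pw rmorph0.
have wNreal : w != w^*.
  apply/eqP => wJ; have /complex_realP[x wx] : w \is Num.real.
    by apply/CrealP.
  by move: (Ppos x); rewrite -wx Pw ltxx.
have /factor_theorem[Q PQ] : root P w by apply/rootP.
have /factor_theorem[S QS] : root Q w^*.
  apply/rootP; move: PwJ; rewrite PQ hornerM hornerXsubC => /eqP.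
  by rewrite mulf_eq0 subr_eq0 [w^* == w]eq_sym (negbTE wNreal) orbF => /eqP.
have PS (x : R) : P.[x%:C%C] = S.[x%:C%C] * `|x%:C%C - w| ^+ 2.
  rewrite PQ QS !hornerM !hornerXsubC normCK rmorphB/= -mulrA.
  congr (_ * _); rewrite mulrC; congr ((_ - _) * (_ - _)).
  by rewrite (CrealP _)//; apply/complex_realP; exists x.
have S_pos (x : R) : 0 < S.[x%:C%C].
  have := Ppos x; rewrite PS pmulr_lgt0// exprn_gt0// normr_gt0 subr_eq0.
  by apply: contraTneq isT => xw; move: (Ppos x); rewrite xw Pw ltxx.
have P0 : P != 0 by apply: contraTneq (Ppos 0) => ->; rewrite horner0 ltxx.
have [|h hS] := IHn S _ S_pos.
  have Q0 : Q != 0 by apply: contraNneq P0; rewrite PQ => ->; rewrite mul0r.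
  have S0 : S != 0 by apply: contraNneq Q0; rewrite QS => ->; rewrite mul0r.
  move: sP; rewrite PQ size_Mmonic ?monicXsubC// size_XsubC.
  rewrite QS size_Mmonic ?monicXsubC// size_XsubC /=; lia.
exists (h * ('X - w%:P)) => x.
by rewrite PS hS hornerM hornerXsubC normrM exprMn.
Qed.

(** Iterated square roots of [-1] give such a root. Powers of two suffice because the averages over
    roots of unity only ask for a large order. *)
Lemma root_of_unity_pow2 (k : nat) :
  exists w : R[i], (2 ^ k.+1)%N.-primitive_root w.
Proof.
have [w wk] : exists w : R[i], w ^+ (2 ^ k) = -1.
  elim: k => [|k [w wk]]; first by exists (-1).
  by exists (sqrtC w); rewrite expnS exprM sqrtCK.
exists w; have w1 : w ^+ (2 ^ k.+1) = 1.
  by rewrite expnSr exprM wk expr2 mulrNN mulr1.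
have [m wm] := prim_order_exists (expn_gt0 2 k.+1) w1.
have prime2 : prime 2 by [].
(* The order is [2 ^ e] with [e <= k.+1]; if [e <= k], it divides [2 ^ k], against
   [w ^+ (2 ^ k) = -1]. *)
case/(dvdn_pfactor _ _ prime2) => e; rewrite leq_eqVlt => /predU1P[-> mE|].
  by rewrite -mE.
rewrite ltnS => /(dvdn_exp2l 2) e_le mE; move: e_le; rewrite -mE.
move=> /dvdnP[q]; rewrite mulnC => wq.
move/eqP: wk; rewrite wq exprM (prim_expr_order wm) expr1n.
by rewrite -subr_eq0 opprK -(natrD _ 1 1) pnatr_eq0.
Qed.

(** Orthogonality of characters: for [b != 0] the sum is geometric with ratio [w ^ b], and [|b| < L]
    excludes the ratio [1]. *)
Lemma sum_root_of_unity (L : nat) (w : R[i]) (b : int) :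
  L.-primitive_root w -> (`|b| < L)%N ->
  \sum_(j < L) (w ^+ j) ^ b = if b == 0 then L%:R else 0.
Proof.
move=> wL bL; have [->|b0] := eqVneq b 0.
  by under eq_bigr do rewrite expr0z; rewrite sumr_const card_ord.
have w0 : w != 0 by rewrite (prim_root_eq0 wL); case: L {wL} bL.
have wb1 : w ^ b != 1.
  have {}b0 : (0 < `|b|)%N by lia.
  have wabs : w ^+ `|b| != 1.
    by rewrite -(prim_order_dvd wL) gtnNdvd.
  have [->|->] : b = `|b|%N :> int \/ b = - (`|b|%N : int) by lia.
    by rewrite -exprnP.
  by rewrite -exprnN invr_eq1.
have wE j : (w ^+ j) ^ b = (w ^ b) ^+ j.
  by rewrite !exprnP !exprz_exp mulrC.
under eq_bigr do rewrite wE.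
have /eqP : (w ^ b - 1) * (\sum_(j < L) (w ^ b) ^+ j) = 0.
  rewrite -subrX1 -wE (prim_expr_order wL) exp1rz subrr //.
by rewrite mulf_eq0 subr_eq0 (negbTE wb1) => /eqP.
Qed.

Lemma norm_root_of_unity (L : nat) (w : R[i]) :
  (0 < L)%N -> w ^+ L = 1 -> `|w| = 1.
Proof.
move=> L0 wL; apply/eqP; rewrite -(@pexpr_eq1 _ _ L) ?normr_ge0 //.
by rewrite -normrX wL normr1.
Qed.
End univariate.

(** * Laurent polynomials and sums of squares *)

Section laurent.
Context {R : realType}.
Local Notation C := R[i].
Implicit Types (z : Cstar R) (q f g : Cstar R -> C).

Lemma Cval_neq0 z : Cval z != 0.
Proof. by case: z => z /[dup]; rewrite {1}inE. Qed.

Lemma Cstar_of (z : C) : z != 0 -> exists z' : Cstar R, Cval z' = z.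
Proof. by move=> z0; exists (exist _ z (mem_set z0)). Qed.

Lemma monomE m n z : monom (m, n) z = Cval z ^ m * (Cval z)^* ^ n.
Proof. by []. Qed.

Lemma conjC_exprz (x : C) (n : int) : (x ^ n)^* = x^* ^ n.
Proof. exact: (@fmorphXz _ _ Num.conj). Qed.

Lemma monom_conj m n z : (monom (m, n) z)^* = monom (n, m) z.
Proof. by rewrite !monomE rmorphM/= !conjC_exprz conjCK mulrC. Qed.

Lemma monomD m n m' n' z :
  monom (m, n) z * monom (m', n') z = monom (m + m', n + n') z.
Proof.
have zJ0 : (Cval z)^* != 0 by rewrite conjC_eq0 Cval_neq0.
by rewrite !monomE mulrACA (expfzDr m m' (Cval_neq0 z)) (expfzDr n n' zJ0).
Qed.

Lemma monom_diag n z : monom (n, n) z = `|Cval z| ^ (n *+ 2).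
Proof.
rewrite monomE -exprzMl ?unitfE ?conjC_eq0 ?Cval_neq0// -normCK.
by rewrite -mulr_natl exprnP exprz_exp.
Qed.

Lemma monom_diag_gt0 n z : 0 < monom (n, n) z.
Proof. by rewrite monom_diag exprz_gt0// normr_gt0 Cval_neq0. Qed.

Lemma monom_polar m n z (x u : C) : Cval z = x * u -> x^* = x -> u^* = u^-1 ->
  monom (m, n) z = x ^ (m + n) * u ^ (m - n).
Proof.
move=> zE xJ uJ; have := Cval_neq0 z; rewrite zE mulf_eq0 negb_or => /andP[x0 u0].
rewrite monomE zE rmorphM/= xJ uJ !exprzMl ?unitfE ?invr_eq0// mulrACA.
by rewrite -expfzDr// exprz_inv -expfzDr.
Qed.

Lemma laurent_fun_seq q : laurent_fun q ->
  exists (s : seq (int * int)) (a : int * int -> C),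
    forall z, q z = \sum_(k <- s) a k * monom k z.
Proof.
move=> [a fa ->]; have [s [_ _ sE]] := finite_system_seq fa.
by exists s, a => z; rewrite /laurent_sum sE.
Qed.

Lemma laurent_fun_bigsum (D : choiceType) (s : seq D) (a : D -> C)
    (e : D -> int * int) :
  laurent_fun (fun z => \sum_(i <- s) a i * monom (e i) z).
Proof.
exists (fun k => \sum_(i <- s) single (e i) (a i) k).
  by apply: finite_system_fsum => i _; exact: finite_system_single.
apply/funext => z; rewrite /laurent_sum fsum_fsum.
  by apply: eq_bigr => i _; rewrite fsum_single.
by move=> i _; exact: finite_system_single.
Qed.

Lemma laurent_fun_conj q : laurent_fun q -> laurent_fun (fun z => (q z)^*).
Proof.
move=> /laurent_fun_seq[s [a qE]].
have := laurent_fun_bigsum s (fun k => (a k)^*) (fun k => (k.2, k.1)).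
congr laurent_fun; apply/funext => z; rewrite qE rmorph_sum.
by apply: eq_bigr => -[m n] _; rewrite rmorphM/= monom_conj.
Qed.

Definition sos f := exists (n : nat) (q : 'I_n -> Cstar R -> C),
  (forall j, laurent_fun (q j)) /\ forall z, f z = \sum_(j < n) `|q j z| ^+ 2.

Lemma sos0 : sos (fun=> 0).
Proof. by exists 0%N, (fun _ _ => 0); split=> [[]//|z]; rewrite big_ord0. Qed.

Lemma sosD f g : sos f -> sos g -> sos (fun z => f z + g z).
Proof.
move=> [n [q [qL fE]]] [m [p [pL gE]]].
exists (n + m)%N, (fun j => match fintype.split j with inl i => q i | inr i => p i end).
split=> [j|z]; first by case: fintype.split.
rewrite fE gE big_split_ord /=; congr (_ + _); apply: eq_bigr => i _.
  by rewrite (unsplitK (inl i)).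
by rewrite (unsplitK (inr i)).
Qed.

Lemma sos_sum (D : eqType) (s : seq D) (f : D -> Cstar R -> C) :
  (forall i, i \in s -> sos (f i)) -> sos (fun z => \sum_(i <- s) f i z).
Proof.
elim: s => [|i s IHs] sf.
  by under eq_fun do rewrite big_nil; exact: sos0.
under eq_fun do rewrite big_cons; apply: sosD; first by apply: sf; rewrite mem_head.
by apply: IHs => j js; apply: sf; rewrite inE js orbT.
Qed.

Lemma sos_normsq a q : 0 <= a -> laurent_fun q ->
  sos (fun z => a * `|q z| ^+ 2).
Proof.
move=> a0 /laurent_fun_seq[s [b qE]].
exists 1%N, (fun _ z => \sum_(k <- s) (sqrtC a * b k) * monom k z).
split=> [_|z]; first exact: laurent_fun_bigsum.
rewrite big_ord1 qE; under [in RHS]eq_bigr do rewrite -mulrA.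
by rewrite -mulr_sumr normrM exprMn (@ger0_norm _ (sqrtC a)) ?sqrtC_ge0// sqrtCK.
Qed.

Lemma sosZ (a : C) f : 0 <= a -> sos f -> sos (fun z => a * f z).
Proof.
move=> a0 [n [q [qL fE]]].
have := sos_sum (s := index_enum 'I_n) (fun j _ => sos_normsq a0 (qL j)).
by congr sos; apply/funext => z; rewrite fE mulr_sumr.
Qed.

Lemma sos_ge0 f z : sos f -> 0 <= f z.
Proof.
by move=> [n [q [_ ->]]]; apply: sumr_ge0 => j _; rewrite exprn_ge0.
Qed.

Lemma sos_diag (a : C) m : 0 <= a -> sos (fun z => a * monom (m, m) z).
Proof.
move=> a0; have := laurent_fun_bigsum [:: (m, 0)] (fun=> 1) id.
move=> /(sos_normsq a0); congr sos; apply/funext => z.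
by rewrite big_seq1 mul1r normCK monom_conj monomD addr0 add0r.
Qed.

(* [2 Re (a z^m zbar^n)] is absorbed by [|a| (|z|^(2m) + |z|^(2n))]. *)
Lemma sos_absorb a m n : sos (fun z =>
  a * monom (m, n) z + (a * monom (m, n) z)^* +
  `|a| * (monom (m, m) z + monom (n, n) z)).
Proof.
have [b [b1 aE]] : exists b : C, b * b^* = 1 /\ a = `|a| * b.
  have [->|a0] := eqVneq a 0; first by exists 1; rewrite normr0 mul0r mul1r conjC1.
  exists (a / `|a|); split; last by rewrite mulrCA divff ?mulr1 ?normr_eq0.
  by rewrite -normCK normrM normfV normr_id divff ?normr_eq0// expr1n.
have /(sos_normsq (normr_ge0 a)) :=
  laurent_fun_bigsum [:: (m, b); (n, 1)] snd (fun k => (k.1, 0)).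
congr sos; apply/funext => z; rewrite !big_cons big_nil/= normCK.
rewrite aE normrM normr_id; have -> : `|b| = 1.
  by apply/eqP; rewrite -(@pexpr_eq1 _ _ 2)// normCK b1.
have aJ : `|a|^* = `|a| by apply/CrealP/normr_real.
rewrite -[monom (m, m) z](_ : monom (m, 0) z * monom (0, m) z = _); last first.
  by rewrite monomD addr0 add0r.
rewrite -[monom (n, n) z](_ : monom (n, 0) z * monom (0, n) z = _); last first.
  by rewrite monomD addr0 add0r.
rewrite -[monom (m, n) z](_ : monom (m, 0) z * monom (0, n) z = _); last first.
  by rewrite monomD addr0 add0r.
have := (monom_conj m 0 z, monom_conj n 0 z, monom_conj 0 n z).
move: (monom (m, 0) z) (monom (0, m) z) (monom (n, 0) z) (monom (0, n) z).
move=> A B A' B' [[JA JA'] JB'].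
rewrite !(rmorphM, rmorphD) /= JA JA' JB' aJ conjC0 conjC1 mulr1.
transitivity (`|a| * ((b * b^*) * (A * B) + b * (A * B') + b^* * (A' * B) + A' * B')).
  by ring.
by rewrite b1; ring.
Qed.

End laurent.

(** * Fejer means *)

Section fejer.
Context {R : realType}.
Local Notation C := R[i].
Implicit Types (z : Cstar R) (q f g : Cstar R -> C).

(* [(x, u)] and [(-x, -u)] are polar coordinates of the same point.  The part of
   a Laurent polynomial in [(x, u)] that is invariant under this sign change is
   a Laurent polynomial in [z] and its conjugate; so is the anti-invariant part
   times [u]. *)
Lemma sos_polar (D : choiceType) (s : seq D) (c : D -> C) (ea eb : D -> int)
    (q : C -> C -> C) :
  (forall x u, q x u = \sum_(i <- s) c i * (x ^ ea i * u ^ eb i)) ->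
  sos (fun z : Cstar R => let x := `|Cval z| in let u := Cval z / `|Cval z| in
    `|q x u| ^+ 2 + `|q (- x) (- u)| ^+ 2).
Proof.
(* The monomial [(m, n)] of [z = x u] is [x ^ ea * u ^ eb] with [ea = m + n] and [eb = m - n], so
   [ea + eb = 2 m] is even. The factor [1 + sg] keeps the even terms and [1 - sg] the odd ones,
   where an additional [u] restores the parity. *)
move=> qE; pose sg i : C := (-1) ^ (ea i + eb i).
pose p i := ((ea i + eb i) %/ 2)%Z.
pose q1 z := \sum_(i <- s) (c i * (1 + sg i)) * monom (p i, ea i - p i) z.
pose q2 z := \sum_(i <- s) (c i * (1 - sg i)) * monom (p i + 1, ea i - p i - 1) z.
have q1L : laurent_fun q1 by exact: laurent_fun_bigsum.
have q2L : laurent_fun q2 by exact: laurent_fun_bigsum.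
have := sosD (sos_normsq (_ : 0 <= 2^-1) q1L) (sos_normsq (_ : 0 <= 2^-1) q2L).
rewrite invr_ge0 ler0n => /(_ isT isT); congr sos; apply/funext => z.
set x := `|Cval z|; set u := Cval z / x => /=.
have x0 : x != 0 by rewrite normr_eq0 Cval_neq0.
have u0 : u != 0 by rewrite mulf_neq0 ?invr_eq0 ?Cval_neq0.
have zE : Cval z = x * u by rewrite mulrC divfK.
have xJ : x^* = x by apply/CrealP/normr_real.
have nu : `|u| = 1 by rewrite normrM normfV normr_id divff.
have uJ : u^* = u^-1.
  by apply: (mulfI u0); rewrite -normCK nu expr1n divff.
clearbody u; clearbody x.
have sgE i : (- x) ^ ea i * (- u) ^ eb i = sg i * (x ^ ea i * u ^ eb i).
  rewrite -(mulN1r x) -(mulN1r u) !exprzMl ?unitfE ?oppr_eq0 ?oner_eq0//.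
  by rewrite mulrACA /sg (@expfzDr _ (-1)) ?oppr_eq0 ?oner_eq0.
have par i : (sg i = 1 /\ ea i + eb i = p i *+ 2) \/
    (sg i = -1 /\ ea i + eb i = p i *+ 2 + 1).
  have N1even k : (-1 : C) ^ (k *+ 2) = 1.
    rewrite mulr2n (@expfzDr _ (-1)) ?oppr_eq0 ?oner_eq0//.
    by rewrite -exprzMl ?unitfE ?oppr_eq0 ?oner_eq0// mulrNN mulr1 exp1rz.
  have := divz_eq (ea i + eb i) 2; have := modz_ge0 (ea i + eb i) (isT : 2 != 0 :> int).
  have := @ltz_pmod (ea i + eb i) 2 isT; rewrite -/(p i) => m2 m0 eE.
  have [e0|e1] : ea i + eb i = p i *+ 2 \/ ea i + eb i = p i *+ 2 + 1 by lia.
    by left; rewrite /sg e0 N1even.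
  by right; rewrite /sg e1 (@expfzDr _ (-1)) ?oppr_eq0 ?oner_eq0// N1even mul1r expr1z.
have q1E : q1 z = q x u + q (- x) (- u).
  rewrite !qE -big_split; apply: eq_bigr => i _ /=.
  rewrite (sgE i) (monom_polar (p i) _ zE xJ uJ) mulrDr mulr1 mulrDl.
  have [[-> e]|[-> e]] := par i; last by ring.
  by rewrite (_ : p i + _ = ea i) 1?(_ : p i - _ = eb i); [ring|lia|lia].
have q2E : q2 z = (q x u - q (- x) (- u)) * u.
  rewrite !qE -sumrB mulr_suml; apply: eq_bigr => i _ /=.
  rewrite (sgE i) (monom_polar (p i + 1) _ zE xJ uJ) mulrBr mulr1.
  have [[-> e]|[-> e]] := par i; first by ring.
  rewrite (_ : p i + 1 + _ = ea i) 1?(_ : p i + 1 - _ = eb i + 1); [|lia|lia].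
  by rewrite (@expfzDr _ u)// expr1z; ring.
(* Parallelogram law: [|A + B|^2 + |A - B|^2 = 2 (|A|^2 + |B|^2)], whence the weights [2^-1]. *)
rewrite q1E q2E normrM nu mulr1; move: (q x u) (q (- x) (- u)) => A B.
by rewrite !normCK !(rmorphD, rmorphN)/=; field.
Qed.

(** This is the coefficient of [t ^ b] in the Fejer kernel [|1 + t + ... + t^(n-1)|^2] on the unit
    circle, that is [max(n - |b|, 0)]; the two bounds below stand in for the closed form. *)
Definition fejer_count (n : nat) (b : int) : nat :=
  (\sum_(i < n) \sum_(j < n) ((i%:Z - j%:Z)%R == b))%N.

Lemma fejer_countN n b : fejer_count n (- b) = fejer_count n b.
Proof.
rewrite /fejer_count exchange_big; apply: eq_bigr => i _; apply: eq_bigr => j _.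
by congr nat_of_bool; apply/eqP/eqP; lia.
Qed.

Lemma fejer_count_le n b : (fejer_count n b <= n)%N.
Proof.
rewrite -[leqRHS]muln1 -[X in (_ <= X * _)%N]card_ord -sum_nat_const.
apply: leq_sum => i _; have [/= j0 ij0|noj] := pickP (fun j : 'I_n => (i%:Z - j%:Z)%R == b).
  rewrite (bigD1 j0)//= ij0 big1 // => j jj0; apply/eqP; rewrite eqb0.
  by apply: contraNneq jj0 => ij; apply/eqP/val_inj => /=; lia.
by rewrite big1 // => j _; rewrite noj.
Qed.

(** By symmetry [b = m >= 0]; each pair [(m + j, j)] with [j < n - m] is counted. *)
Lemma fejer_count_ge n b : (n <= fejer_count n b + `|b|)%N.
Proof.
wlog [m ->] : b / exists m : nat, b = m.
  move=> H; have [[m ->]|[m ->]] : (exists m : nat, b = m) \/ (exists m : nat, b = - m%:Z).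
    have [b0|b0] := lerP 0 b; [left|right]; exists `|b|%N; lia.
  - by apply: H; exists m.
  - by rewrite fejer_countN abszN; apply: H; exists m.
rewrite absz_nat; have [nm|mn] := leqP n m; first lia.
rewrite addnC -leq_subLR -[leqLHS]muln1 -[X in (X * _ <= _)%N]card_ord -sum_nat_const.
rewrite /fejer_count exchange_big /=.
rewrite (big_ord_widen n (fun=> 1%N)) ?leq_subr// big_mkcond /=.
apply: leq_sum => j _; case: ifPn => // jb.
have bj : (m + j < n)%N by lia.
by rewrite (bigD1 (Ordinal bj))//= PoszD addrK eqxx.
Qed.

Lemma norm_geom_sum (n : nat) (t : C) : t != 0 -> t^* = t^-1 ->
  `|\sum_(i < n) t ^+ i| ^+ 2 = \sum_(i < n) \sum_(j < n) t ^ (i%:Z - j%:Z).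
Proof.
move=> t0 tJ; rewrite normCK rmorph_sum big_distrlr /=.
apply: eq_bigr => i _; apply: eq_bigr => j _.
by rewrite rmorphXn /= tJ expfzDr// -exprnN -exprVn.
Qed.

Lemma absz_sub_lt (b : int) (n L i j : nat) : (`|b| + n <= L)%N ->
  (i < n)%N -> (j < n)%N -> (`|(b - (i%:Z - j%:Z))%R| < L)%N.
Proof. lia. Qed.

(** A discrete convolution with the Fejer kernel. The sum over roots of unity keeps only the pairs
    with [i - j = k.1 - k.2]; since [L] is at least [|k.1 - k.2| + n], there is no aliasing. *)
Lemma fejer_mean (s : seq (int * int)) (a : int * int -> C) (n L : nat)
    (w x u : C) : (forall k, k \in s -> `|k.1 - k.2| + n <= L)%N ->
  L.-primitive_root w -> u != 0 -> u^* = u^-1 ->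
  \sum_(l < L) (\sum_(k <- s) a k * (x ^ (k.1 + k.2) * (w ^+ l) ^ (k.1 - k.2))) *
    `|\sum_(i < n) (u / w ^+ l) ^+ i| ^+ 2 =
  L%:R * \sum_(k <- s) (fejer_count n (k.1 - k.2))%:R *
    (a k * (x ^ (k.1 + k.2) * u ^ (k.1 - k.2))).
Proof.
move=> sL wL u0 uJ; have L0 := prim_order_gt0 wL.
have w0 l : w ^+ l != 0.
  by rewrite expf_eq0 (prim_root_eq0 wL) eqn0Ngt L0 andbF.
have wJ l : (w ^+ l)^* = (w ^+ l)^-1.
  apply: (mulfI (w0 l)); rewrite -normCK normrX.
  by rewrite (norm_root_of_unity L0 (prim_expr_order wL)) !expr1n divff.
under eq_bigr => l _.
  rewrite norm_geom_sum ?mulf_neq0 ?invr_eq0//; last first.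
    by rewrite rmorphM/= fmorphV/= uJ wJ invfM.
  over.
transitivity (\sum_(k <- s) a k * x ^ (k.1 + k.2) * \sum_(i < n) \sum_(j < n)
    (u ^ (i%:Z - j%:Z) * \sum_(l < L) (w ^+ l) ^ (k.1 - k.2 - (i%:Z - j%:Z)))).
  under eq_bigr do rewrite mulr_suml.
  rewrite exchange_big; apply: eq_bigr => k _ /=.
  under eq_bigr => l _.
    rewrite mulrA -mulrA mulr_sumr.
    under eq_bigr => i _.
      rewrite mulr_sumr; under eq_bigr => j _.
        rewrite exprzMl ?unitfE ?invr_eq0// mulrCA exprz_inv -expfzDr//.
        over.
      over.
    over.
  rewrite -mulr_sumr exchange_big; congr (_ * _); apply: eq_bigr => i _ /=.
  by rewrite exchange_big; apply: eq_bigr => j _ /=; rewrite mulr_sumr.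
rewrite mulr_sumr; apply: eq_big_seq => k /sL kL.
rewrite /fejer_count natr_sum mulr_suml !mulr_sumr; apply: eq_bigr => i _.
rewrite natr_sum mulr_suml !mulr_sumr; apply: eq_bigr => j _.
rewrite (sum_root_of_unity wL); last first.
  exact: absz_sub_lt kL (ltn_ord i) (ltn_ord j).
rewrite subr_eq0 eq_sym; case: eqP => [->|_]; last by rewrite !(mul0r, mulr0).
by rewrite mul1r; ring.
Qed.

End fejer.

(** * Approximation of nonnegative Laurent polynomials by sums of squares *)

Section approximation.
Context {R : realType}.
Local Notation C := R[i].
Implicit Types (z : Cstar R) (q f g : Cstar R -> C).

(** [m + n] and [m - n] have the same parity. *)
Lemma exprzN_even (x u : C) (m n : int) :
  (- x) ^ (m + n) * (- u) ^ (m - n) = x ^ (m + n) * u ^ (m - n).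
Proof.
have N1u : (-1 : C) != 0 by rewrite oppr_eq0 oner_eq0.
rewrite -(mulN1r x) -(mulN1r u) !expfzMl mulrACA.
rewrite -[X in X * _](expfzDr _ _ N1u) addrACA subrr addr0 (expfzDr _ _ N1u).
by rewrite -expfzMl mulrNN mulr1 exp1rz mul1r.
Qed.

(** At each root of unity [v = w ^+ l] the restriction to the line is a squared modulus in [x] and
    the kernel is one in [u]; their product is [|q l x u|^2], to which [sos_polar] applies. *)
Lemma fejer_sos (s : seq (int * int)) (a : int * int -> C) (N n : nat) :
  (forall v : C, v != 0 -> v^* = v^-1 -> exists h : {poly C}, forall x : R,
    x != 0 -> \sum_(k <- s) a k * (x%:C%C ^ (k.1 + k.2) * v ^ (k.1 - k.2)) =
      (x%:C%C ^ (- N%:Z)) ^+ 2 * `|h.[x%:C%C]| ^+ 2) ->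
  sos (fun z => \sum_(k <- s) (fejer_count n (k.1 - k.2))%:R * (a k * monom k z)).
Proof.
move=> H; pose e := (\sum_(k <- s) `|(k.1 - k.2)%R| + n)%N.
pose L := (2 ^ e.+1)%N; have [w wL] : exists w : C, L.-primitive_root w.
  exact: root_of_unity_pow2.
have L0 : (0 < L)%N := prim_order_gt0 wL.
have w0 l : w ^+ l != 0.
  by rewrite expf_eq0 (prim_root_eq0 wL) eqn0Ngt L0 andbF.
have wJ l : (w ^+ l)^* = (w ^+ l)^-1.
  apply: (mulfI (w0 l)); rewrite -normCK normrX.
  by rewrite (norm_root_of_unity L0 (prim_expr_order wL)) !expr1n divff.
have eL : (e <= L)%N.
  by apply: leq_trans (ltnW (ltn_expl e (ltnSn 1))) _; rewrite leq_exp2l.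
have sL k : k \in s -> (`|(k.1 - k.2)%R| + n <= L)%N.
  move=> ks; apply: leq_trans eL; rewrite /e (big_rem _ ks) /=.
  by rewrite leq_add2r leq_addr.
have /choice[h hE] := fun l => H (w ^+ l) (w0 l) (wJ l).
pose q l x u := \sum_(p : 'I_(size (h l)) * 'I_n)
  ((h l)`_p.1 * (w ^+ l) ^- p.2) * (x ^ (p.1%:Z - N%:Z) * u ^ p.2%:Z) : C.
have qE l (x u : C) : x != 0 -> q l x u =
    x ^ (- N%:Z) * (h l).[x] * \sum_(j < n) (u / w ^+ l) ^+ j.
  move=> x0; rewrite -mulrA horner_coef big_distrlr /= pair_bigA mulr_sumr.
  apply: eq_bigr => -[i j] _ /=; rewrite expfzDr// -!exprnP exprMn exprVn.
  by ring.
have qsum (x u : C) : x \is Num.real -> x != 0 -> u != 0 -> u^* = u^-1 ->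
    \sum_(l < L) `|q l x u| ^+ 2 = L%:R * \sum_(k <- s)
    (fejer_count n (k.1 - k.2))%:R * (a k * (x ^ (k.1 + k.2) * u ^ (k.1 - k.2))).
  move=> xR x0 u0 uJ; rewrite -(fejer_mean a x sL wL u0 uJ).
  apply: eq_bigr => l _; rewrite qE// !normrM !exprMn.
  rewrite (real_normK (rpredXz _ xR)).
  have [r xr] := complex_realP _ xR; rewrite {}xr in x0 *.
  by rewrite hE// -(inj_eq (@complexI _)).
have sos_q l := sos_polar (fun x u => erefl (q l x u)).
(* The factor [2] counts the two polar representations of [z], the factor [L] the roots of unity. *)
have := sosZ (_ : 0 <= (2 * L%:R)^-1) (sos_sum (s := index_enum 'I_L) (fun l _ => sos_q l)).
rewrite invr_ge0 mulr_ge0 ?ler0n// => /(_ isT); congr sos.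
apply/funext => z /=; rewrite big_split /=.
set x := `|Cval z|; set u := Cval z / x.
have x0 : x != 0 by rewrite normr_eq0 Cval_neq0.
have u0 : u != 0 by rewrite mulf_neq0 ?invr_eq0 ?Cval_neq0.
have zE : Cval z = x * u by rewrite mulrC divfK.
have xR : x \is Num.real by apply: normr_real.
have xJ : x^* = x by apply/CrealP.
have uJ : u^* = u^-1.
  by apply: (mulfI u0); rewrite -normCK normrM normfV normr_id divff ?expr1n ?divff.
clearbody u; clearbody x.
rewrite (qsum x u)// (qsum (- x) (- u)) ?oppr_eq0 ?rpredN//; last first.
  by rewrite rmorphN/= uJ invrN.
rewrite -mulrDr mulrA -big_split mulr_sumr; apply: eq_bigr => k _ /=.
case: k => m j; rewrite (monom_polar m j zE xJ uJ) /= (exprzN_even x u m j).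
by field; rewrite pnatr_eq0 -lt0n.
Qed.

(** The diagonal terms at [N] and [- N] make the sum strictly positive on lines; those at [k.1] and
    [k.2] absorb the difference between the sum and its Fejer mean. *)
Lemma sos_approx (s : seq (int * int)) (a : int * int -> C) (N : nat) (d : R) :
  (forall k, k \in s -> (`|k.1| < N)%N && (`|k.2| < N)%N) ->
  (forall z, 0 <= \sum_(k <- s) a k * monom k z) -> 0 < d ->
  sos (fun z => \sum_(k <- s) a k * monom k z + d%:C%C *
    (monom (N%:Z, N%:Z) z + monom (- N%:Z, - N%:Z) z +
     \sum_(k <- s) (monom (k.1, k.1) z + monom (k.2, k.2) z))).
Proof.
move=> sN f_ge0 d0; have dC0 : 0 < d%:C%C :> C by rewrite ltcR.
(* No index of [s] has a first entry of absolute value [N], so the two new indices get the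
   coefficient [d] while [a] is unchanged on [s]. *)
pose a' k := if `|k.1|%N == N then d%:C%C else a k.
pose s' := (N%:Z, N%:Z) :: (- N%:Z, - N%:Z) :: s.
have a's k : k \in s -> a' k = a k.
  by move=> /sN /andP[kN _]; rewrite /a' ltn_eqF.
have a'N1 : a' (N%:Z, N%:Z) = d%:C%C by rewrite /a' eqxx.
have a'N2 : a' (- N%:Z, - N%:Z) = d%:C%C by rewrite /a' abszN eqxx.
have sum_s' (F : int * int -> C) : \sum_(k <- s') a' k * F k =
    d%:C%C * (F (N%:Z, N%:Z) + F (- N%:Z, - N%:Z)) + \sum_(k <- s) a k * F k.
  rewrite !big_cons a'N1 a'N2 addrA mulrDr; congr (_ + _).
  by apply: eq_big_seq => k /a's ->.
have H v : v != 0 -> v^* = v^-1 -> exists h : {poly C}, forall x : R,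
    x != 0 -> \sum_(k <- s') a' k * (x%:C%C ^ (k.1 + k.2) * v ^ (k.1 - k.2)) =
      (x%:C%C ^ (- N%:Z)) ^+ 2 * `|h.[x%:C%C]| ^+ 2.
  (* [P] is [x ^ (2 N)] times the restriction to the line. It has to be positive at [x = 0] too,
     where the index [(- N, - N)] contributes the constant term [d]. *)
  move=> v0 vJ; pose P : {poly C} := \sum_(k <- s')
    (a' k * v ^ (k.1 - k.2)) *: 'X^(`|(k.1 + k.2 + N%:Z *+ 2)%R|).
  have kN k : k \in s' -> 0 <= k.1 + k.2 + N%:Z *+ 2.
    rewrite !inE => /orP[/eqP->|/orP[/eqP->|/sN]] /=; lia.
  have PE (x : R) : x != 0 -> \sum_(k <- s') a' k * (x%:C%C ^ (k.1 + k.2) * v ^ (k.1 - k.2)) =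
      (x%:C%C ^ (- N%:Z)) ^+ 2 * P.[x%:C%C].
    rewrite -(inj_eq (@complexI _)); move: (x%:C%C) => y y0.
    rewrite horner_sum mulr_sumr; apply: eq_big_seq => k /kN kN0.
    have yD i j : y ^ i * y ^ j = y ^ (i + j) by rewrite expfzDr.
    have -> : (y ^ (- N%:Z)) ^+ 2 = y ^ (- (N%:Z *+ 2)).
      by rewrite mulr2n opprD -yD.
    rewrite hornerZ hornerXn (exprnP _ `|_|%N) (gez0_abs kN0).
    have yE : y ^ (k.1 + k.2) = y ^ (- (N%:Z *+ 2)) * y ^ (k.1 + k.2 + N%:Z *+ 2).
      by rewrite yD [k.1 + k.2 + _]addrC addKr.
    rewrite {}yE; move: (y ^ _) (y ^ _) (v ^ _) (a' k) => y1 y2 v1 a1.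
    by ring.
  have [x|h hP] := poly_pos_normsq (P := P); last first.
    by exists h => x x0; rewrite PE// hP.
  have [->|x0] := eqVneq x 0.
    rewrite horner_sum; under eq_bigr do rewrite hornerZ hornerXn -mulrA.
    rewrite (sum_s' (fun k => v ^ (k.1 - k.2) * 0%:C%C ^+ `|k.1 + k.2 + N%:Z *+ 2|)).
    rewrite big1_seq ?addr0 => [|k /andP[_ /sN]]; last first.
      case: k => m n /= mnN; rewrite expr0n.
      by rewrite (_ : `|_|%N == 0%N = false) ?mulr0//; apply/eqP; lia.
    rewrite mulr_gt0// !subrr !expr0z !mul1r (_ : - N%:Z - N%:Z + _ = 0); last lia.
    by rewrite expr0 addrC ltr_pwDl// exprn_ge0.
  have xC0 : x%:C%C != 0 :> C by rewrite (inj_eq (@complexI _)).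
  have [z zE] := Cstar_of (mulf_neq0 xC0 v0).
  have xJ : x%:C%C^* = x%:C%C by apply/CrealP/complex_realP; exists x.
  have xN0 : 0 < (x%:C%C ^ (- N%:Z)) ^+ 2.
    rewrite -(@real_normK _ (x%:C%C ^ _)); last by rewrite rpredXz//; apply/CrealP.
    by rewrite exprn_gt0// normr_gt0 expfz_neq0.
  rewrite -(pmulr_rgt0 _ xN0) -PE//.
  under eq_bigr do rewrite -(monom_polar _ _ zE xJ vJ).
  rewrite (sum_s' (fun k => monom (k.1, k.2) z)) ltr_pwDl//.
    by rewrite mulr_gt0// addr_gt0 ?monom_diag_gt0.
  have := f_ge0 z; rewrite (eq_bigr (fun k => a k * monom (k.1, k.2) z))//.
(* The Fejer mean changes the coefficient at [k] by at most [|a k| |k.1 - k.2| / n]; this [n] brings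
   the change below [d]. *)
have [n n0 nd] : exists2 n : nat, (0 < n)%N & forall k, k \in s ->
    `|a k| * `|k.1 - k.2|%N%:R <= d%:C%C * n%:R.
  pose M := \sum_(k <- s) complex.Re `|a k| * `|(k.1 - k.2)%R|%:R.
  have aE k : (complex.Re `|a k|)%:C%C = `|a k| by exact/RRe_real/normr_real.
  have a0 k : 0 <= complex.Re `|a k| by rewrite -ler0c aE.
  have M0 : 0 <= M by apply: sumr_ge0 => k _; rewrite mulr_ge0.
  exists (Num.bound (M / d)).
    by rewrite -(ltr_nat R); apply: le_lt_trans (archi_boundP _); rewrite divr_ge0// ltW.
  move=> k ks; rewrite -aE -!(rmorph_nat (real_complex R)) -!rmorphM lecR.
  apply: (@le_trans _ _ M).
    rewrite /M (big_rem _ ks) lerDl sumr_ge0// => i _.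
    exact: mulr_ge0 (a0 i) (ler0n _ _).
  rewrite -ler_pdivrMl// mulrC; apply/ltW/archi_boundP.
  by rewrite divr_ge0// ltW.
have := sosZ (_ : 0 <= (n%:R)^-1) (fejer_sos n H).
rewrite invr_ge0 ler0n => /(_ isT).
set Sn := (fun z => _ * _) => SnS.
have fn0 : fejer_count n 0 = n.
  apply/eqP; rewrite eqn_leq fejer_count_le.
  by have := fejer_count_ge n 0; rewrite absz0 addn0.
pose t k : C := 1 - (fejer_count n (k.1 - k.2))%:R / n%:R.
have nC : (n%:R : C) != 0 by rewrite pnatr_eq0 -lt0n.
have t0 k : 0 <= t k.
  by rewrite subr_ge0 ler_pdivrMr ?ltr0n// mul1r ler_nat fejer_count_le.
have tn k : t k * n%:R <= `|(k.1 - k.2)%R|%N%:R.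
  rewrite mulrBl mul1r divfK// lerBlDl -natrD ler_nat.
  exact: fejer_count_ge.
have SnE z : \sum_(k <- s) a k * monom k z +
    d%:C%C * (monom (N%:Z, N%:Z) z + monom (- N%:Z, - N%:Z) z) =
    Sn z + \sum_(k <- s) t k * (a k * monom k z).
  have -> : Sn z = n%:R^-1 * \sum_(k <- s') a' k * ((fejer_count n (k.1 - k.2))%:R * monom k z).
    by rewrite /Sn; congr (_ * _); apply: eq_bigr => k _; rewrite mulrCA.
  rewrite (sum_s' (fun k => (fejer_count n (k.1 - k.2))%:R * monom k z)) /=.
  rewrite !subrr fn0 [in RHS](mulrDr n%:R^-1) [in RHS]mulr_sumr.
  rewrite [RHS]addrAC -addrA -big_split addrC; congr (_ + _).
    by apply: eq_bigr => k _; rewrite /t /=; field.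
  by field.
(* The left-hand side of [SnE] and [Sn] are real, hence so is the error; it is half its sum with its
   conjugate, the form that [sos_absorb] treats. *)
have E_real z : (\sum_(k <- s) t k * (a k * monom k z))^* =
    \sum_(k <- s) t k * (a k * monom k z).
  apply/CrealP; rewrite -(rpredDl _ (ger0_real (sos_ge0 z SnS))) -SnE.
  by rewrite rpredD ?ger0_real// mulr_ge0 ?ltW// addr_gt0 ?monom_diag_gt0.
(* Absorbing a term costs [t k / 2 * |a k|] on two diagonal monomials; by the choice of [n] this is
   at most [d], and the rest is a nonnegative diagonal term. *)
have sos_k k : k \in s -> sos (fun z =>
    (t k / 2) * (a k * monom k z + (a k * monom k z)^* +
    `|a k| * (monom (k.1, k.1) z + monom (k.2, k.2) z)) +
    ((d%:C%C - t k / 2 * `|a k|) * monom (k.1, k.1) z +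
     (d%:C%C - t k / 2 * `|a k|) * monom (k.2, k.2) z)).
  move=> ks; have td : 0 <= d%:C%C - t k / 2 * `|a k|.
    rewrite subr_ge0 -(@ler_pM2r _ n%:R) ?ltr0n//.
    apply: le_trans (nd k ks).
    have -> : t k / 2 * `|a k| * n%:R = `|a k| * (t k * n%:R / 2) by field.
    rewrite ler_wpM2l// ler_pdivrMr ?ltr0n//; apply: le_trans (tn k) _.
    by rewrite mulr_natr mulr2n lerDl.
  apply: sosD; last by apply: sosD; apply: sos_diag.
  apply: sosZ; first by rewrite divr_ge0.
  by case: (k) => m j; exact: sos_absorb.
have := sosD SnS (sos_sum sos_k); congr sos; apply/funext => z.
rewrite mulrDr addrA SnE -addrA; congr (_ + _).
have -> : \sum_(k <- s) t k * (a k * monom k z) =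
    \sum_(k <- s) t k / 2 * (a k * monom k z + (a k * monom k z)^*).
  rewrite -[LHS](mulfK (_ : 2 != 0)) ?pnatr_eq0// mulr_natr mulr2n -{2}E_real.
  rewrite rmorph_sum -big_split mulr_suml; apply: eq_bigr => k _ /=.
  by rewrite rmorphM/= (CrealP (ger0_real (t0 k))) -mulrDr mulrAC.
rewrite mulr_sumr -big_split; apply: eq_bigr => k _ /=.
by field.
Qed.

End approximation.

(** * Determining sets and complex integrals *)

Section equivalences.
Context {R : realType}.
Local Notation C := R[i].
Implicit Types (z : Cstar R) (f g : Cstar R -> C).

(** The error in [sos_approx] is [d] times a system [e] that is supported on the diagonal and
    independent of [d], so the inequality for [p + d e] passes to the limit. *)
Lemma sos_cone_nonneg (T : set (int * int)) (c p : int * int -> C) :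
  (forall n, T (n, n)) ->
  (forall p, finite_system T p -> sos (laurent_sum T p) ->
     0 <= \sum_(k \in T) p k * c k) ->
  finite_system T p -> (forall z, 0 <= laurent_sum T p z) ->
  0 <= \sum_(k \in T) p k * c k.
Proof.
move=> Td Tsos fp p0; have [s [_ sT sE]] := finite_system_seq fp.
pose N := (\sum_(k <- s) (`|k.1| + `|k.2|)).+1%N.
have sN k : k \in s -> (`|k.1| < N)%N && (`|k.2| < N)%N.
  by move=> ks; rewrite /N !ltnS (big_rem _ ks) /=; apply/andP; split; lia.
pose e0 (n : int) := single (n, n) (1 : C).
pose e2 k := e0 N%:Z k + e0 (- N%:Z) k.
pose e3 k := \sum_(i <- s) (e0 i.1 k + e0 i.2 k).
have fe0 n : finite_system T (e0 n) by exact: finite_system_single.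
have fe3i i : finite_system T (fun k => e0 i.1 k + e0 i.2 k).
  exact: finite_systemD.
have fe2 : finite_system T e2 by exact: finite_systemD.
have fe3 : finite_system T e3.
  by apply: finite_system_fsum => i _.
pose e k := e2 k + e3 k; have fe : finite_system T e by exact: finite_systemD.
have eE (g : int * int -> C) : \sum_(k \in T) e k * g k =
    g (N%:Z, N%:Z) + g (- N%:Z, - N%:Z) + \sum_(i <- s) (g (i.1, i.1) + g (i.2, i.2)).
  rewrite fsumD// fsumD// !fsum_single// !mul1r; congr (_ + _).
  rewrite fsum_fsum//; apply: eq_bigr => i _.
  by rewrite fsumD// !fsum_single// !mul1r.
apply: (@ge0_complex_lim _ _ (\sum_(k \in T) e k * c k)) => d d0.
have fde : finite_system T (fun k => d%:C%C * e k) by exact: finite_systemZ.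
rewrite -fsumZ -fsumD//; apply: Tsos; first exact: finite_systemD.
have p0' z : 0 <= \sum_(k <- s) p k * monom k z by rewrite -sE; exact: p0.
have := sos_approx sN p0' d0; congr sos; apply/funext => z.
by rewrite /laurent_sum fsumD// fsumZ eE sE.
Qed.

(** The factor [|z|^(2N)], positive on the punctured plane, clears negative exponents, because
    [determining] speaks of polynomials. *)
Definition polynomial_up_to_power f := exists (N : nat) (P : {poly {poly C}}),
  forall z, monom (N%:Z, N%:Z) z * f z = P.[(Cval z)%:P].[(Cval z)^*].

Lemma polynomial_power (N : nat) z :
  (('X * 'X%:P) ^+ N : {poly {poly C}}).[(Cval z)%:P].[(Cval z)^*] =
  monom (N%:Z, N%:Z) z.
Proof.
rewrite monomE -!exprnP !horner_exp hornerM hornerX hornerC hornerM hornerC.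
by rewrite hornerX exprMn.
Qed.

Lemma polynomial_up_to_powerD f g : polynomial_up_to_power f ->
  polynomial_up_to_power g -> polynomial_up_to_power (fun z => f z + g z).
Proof.
move=> [N1 [P1 fP]] [N2 [P2 gP]]; exists (N1 + N2)%N.
exists (('X * 'X%:P) ^+ N2 * P1 + ('X * 'X%:P) ^+ N1 * P2) => z.
rewrite !hornerD !hornerM !polynomial_power -fP -gP PoszD -monomD.
by ring.
Qed.

Lemma polynomial_up_to_powerM f g : polynomial_up_to_power f ->
  polynomial_up_to_power g -> polynomial_up_to_power (fun z => f z * g z).
Proof.
move=> [N1 [P1 fP]] [N2 [P2 gP]]; exists (N1 + N2)%N, (P1 * P2) => z.
by rewrite !hornerM -fP -gP PoszD -monomD mulrACA.
Qed.

Lemma polynomial_up_to_power_sum (D : Type) (s : seq D) (f : D -> Cstar R -> C) :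
  (forall i, polynomial_up_to_power (f i)) ->
  polynomial_up_to_power (fun z => \sum_(i <- s) f i z).
Proof.
move=> fP; elim: s => [|i s IHs].
  by exists 0%N, 0 => z; rewrite big_nil mulr0 !horner0.
under [X in polynomial_up_to_power X]eq_fun do rewrite big_cons.
exact: polynomial_up_to_powerD.
Qed.

Lemma polynomial_up_to_power_monom a k :
  polynomial_up_to_power (fun z => a * monom k z).
Proof.
case: k => m n; pose N := (`|m| + `|n|)%N.
exists N, (a%:P%:P * 'X^(`|m + N%:Z|) * ('X^(`|n + N%:Z|))%:P) => z.
rewrite mulrCA monomD monomE !hornerM !hornerC hornerXn horner_exp !hornerC.
rewrite hornerXn -mulrA !exprnP !gez0_abs 1?addrC 1?[_ + n]addrC //; lia.
Qed.

Lemma laurent_fun_polynomial f : laurent_fun f -> polynomial_up_to_power f.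
Proof.
move=> /laurent_fun_seq[s [a fE]].
have := polynomial_up_to_power_sum s (fun k => polynomial_up_to_power_monom (a k) k).
by congr polynomial_up_to_power; apply/funext.
Qed.

Lemma determining_eq (Z : set C) f g : determining Z ->
  Z `<=` [set z | z != 0] ->
  polynomial_up_to_power f -> polynomial_up_to_power g ->
  (forall z, Z (Cval z) -> f z = g z) -> forall z, f z = g z.
Proof.
move=> Zdet Z0 fP gP fg z.
have [N [P dP]] : polynomial_up_to_power (fun z => f z + (-1) * g z).
  apply: polynomial_up_to_powerD => //; apply: polynomial_up_to_powerM => //.
  have := polynomial_up_to_power_monom (-1) (0, 0).
  by congr polynomial_up_to_power; apply/funext => w; rewrite monomE mulr1 mulr1.
have P0 w : P.[w%:P].[w^*] = 0.
  apply: Zdet => {}w Zw; have [w' w'E] := Cstar_of (Z0 _ Zw).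
  by rewrite -w'E -dP fg ?w'E// mulN1r subrr mulr0.
have /eqP := dP z; rewrite P0 mulf_eq0 gt_eqF ?monom_diag_gt0//= mulN1r.
by rewrite subr_eq0 => /eqP.
Qed.

End equivalences.

(** * Linearity and positivity of the complex integral *)

Section complex_integral_linear.
Context {R : realType} d (X : measurableType d) (mu : {measure set X -> \bar R}).
Local Notation C := R[i].
Implicit Types (a : C) (f g : X -> C).

Lemma cintegrableD f g : cintegrable mu f -> cintegrable mu g ->
  cintegrable mu (fun x => f x + g x).
Proof.
move=> [fr fi] [gr gi]; split.
  have := integrableD measurableT fr gr; congr (_.-integrable _ _).
  by apply/funext => x /=; case: (f x) (g x) => ? ? [].
have := integrableD measurableT fi gi; congr (_.-integrable _ _).
by apply/funext => x /=; case: (f x) (g x) => ? ? [].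
Qed.

Lemma cintegralD f g : cintegrable mu f -> cintegrable mu g ->
  cintegral mu (fun x => f x + g x) = cintegral mu f + cintegral mu g.
Proof.
move=> [fr fi] [gr gi]; rewrite [RHS]/GRing.add/= -!RintegralD//.
by congr Complex; apply: eq_Rintegral => x _; case: (f x) (g x) => ? ? [].
Qed.

Lemma cintegrableZ a f : cintegrable mu f -> cintegrable mu (fun x => a * f x).
Proof.
move=> [fr fi]; split.
  have := integrableB measurableT (integrableZl measurableT (complex.Re a) fr)
    (integrableZl measurableT (complex.Im a) fi).
  congr (_.-integrable _ _); apply/funext => x /=.
  by case: a (f x) => ? ? [].
have := integrableD measurableT (integrableZl measurableT (complex.Re a) fi)
  (integrableZl measurableT (complex.Im a) fr).
congr (_.-integrable _ _); apply/funext => x /=.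
by case: a (f x) => ? ? [].
Qed.

Lemma cintegralZ a f : cintegrable mu f ->
  cintegral mu (fun x => a * f x) = a * cintegral mu f.
Proof.
move=> [fr fi]; case: a => ar ai; rewrite [RHS]/GRing.mul/=.
rewrite -!RintegralZl// -RintegralB//; last 2 first.
- exact: (integrableZl measurableT ar fr).
- exact: (integrableZl measurableT ai fi).
rewrite -RintegralD//; last 2 first.
- exact: (integrableZl measurableT ar fi).
- exact: (integrableZl measurableT ai fr).
by congr Complex; apply: eq_Rintegral => x _ /=; case: (f x).
Qed.

Lemma Rintegral_eq0 (f : X -> R) : (forall x, f x = 0) ->
  \int[mu]_x f x = 0.
Proof. by move=> f0; rewrite /Rintegral integral0_eq// => x _; rewrite f0. Qed.

Lemma cintegral_sum (I : eqType) (s : seq I) (a : I -> C) (f : I -> X -> C) :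
  (forall i, i \in s -> cintegrable mu (f i)) ->
  cintegrable mu (fun x => \sum_(i <- s) a i * f i x) /\
  cintegral mu (fun x => \sum_(i <- s) a i * f i x) =
    \sum_(i <- s) a i * cintegral mu (f i).
Proof.
elim: s => [|i s IHs] fs.
  under eq_fun do rewrite big_nil.
  rewrite big_nil; split; last by rewrite /cintegral !Rintegral_eq0.
  by split; exact: integrable0.
have [|fi sE] := IHs; first by move=> j js; apply: fs; rewrite inE js orbT.
have afi : cintegrable mu (fun x => a i * f i x).
  by apply/cintegrableZ/fs; rewrite mem_head.
under eq_fun do rewrite big_cons; split; first exact: cintegrableD.
by rewrite cintegralD// sE big_cons cintegralZ//; apply: fs; rewrite mem_head.
Qed.

Lemma cintegral_ge0 f : (forall x, 0 <= f x) -> 0 <= cintegral mu f.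
Proof.
move=> f0; rewrite lecE /=; apply/andP; split.
  by rewrite eq_sym Rintegral_eq0// => x; exact/ger0_Im/f0.
apply: Rintegral_ge0 => x _; by have := f0 x; rewrite lecE => /andP[].
Qed.

End complex_integral_linear.

(** * Hahn-Banach *)

Section hahn_banach.
Context {R : realType} {U : lmodType R}.
Implicit Types (p q : U -> R) (x y : U) (t : R).

Definition sublinear q := (forall x y, q (x + y) <= q x + q y) /\
  (forall t x, 0 <= t -> q (t *: x) <= t * q x).

Lemma sublinear0 q : sublinear q -> q 0 = 0.
Proof.
move=> [qD qZ]; apply/le_anti; have := qZ 0 0 (lexx _).
by rewrite scale0r mul0r => -> /=; have := qD 0 0; rewrite addr0; lra.
Qed.

(** The converse inequality is the defining one for [t^-1] at [t *: x]. *)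
Lemma sublinearZ q t x : sublinear q -> 0 <= t -> q (t *: x) = t * q x.
Proof.
move=> sq; rewrite le_eqVlt => /predU1P[<-|t0].
  by rewrite scale0r mul0r sublinear0.
apply/le_anti/andP; split; first exact/sq.2/ltW.
rewrite -ler_pdivlMl//.
rewrite -{1}(scale1r x) -(mulVf (lt0r_neq0 t0)) -scalerA.
by apply: sq.2; rewrite invr_ge0 ltW.
Qed.

Lemma sublinear_ge q x : sublinear q -> - q (- x) <= q x.
Proof.
by move=> sq; rewrite -subr_ge0 opprK -(sublinear0 sq) -[in leLHS](subrr x) sq.1.
Qed.

Lemma inf_le_lbound (A : set R) a m : (forall b, A b -> m <= b) -> A a -> inf A <= a.
Proof. by move=> Am Aa; apply: ge_inf => //; exists m. Qed.

Lemma le_inf_sum (A B : set R) m : A !=set0 -> B !=set0 ->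
  (forall a b, A a -> B b -> m <= a + b) -> m <= inf A + inf B.
Proof.
move=> A0 B0 AB; rewrite -lerBlDr; apply: lb_le_inf => // a Aa.
rewrite lerBlDr -lerBlDl; apply: lb_le_inf => // b Bb.
by rewrite lerBlDl AB.
Qed.

(** The pointwise infimum of the chain is finite because [- q (- x)] bounds it below. For
    subadditivity, two members of the chain are replaced by the smaller one. *)
Lemma sublinear_inf_chain q (A : set (U -> R)) : sublinear q ->
  A !=set0 -> (forall p, A p -> sublinear p /\ forall x, p x <= q x) ->
  (forall p1 p2, A p1 -> A p2 -> (forall x, p1 x <= p2 x) \/ (forall x, p2 x <= p1 x)) ->
  exists p, [/\ sublinear p, (forall x, p x <= q x) &
    forall p', A p' -> forall x, p x <= p' x].
Proof.
move=> sq [p0 Ap0] Aq Atot; pose v x := [set p x | p in A].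
have v0 x : v x !=set0 by exists (p0 x), p0.
have vge x b : v x b -> - q (- x) <= b.
  move=> [p Ap <-]; have [sp pq] := Aq _ Ap.
  by apply: le_trans (sublinear_ge x sp); rewrite lerN2.
have infle p x : A p -> inf (v x) <= p x.
  by move=> Ap; apply: inf_le_lbound (vge x) _; exists p.
exists (fun x => inf (v x)); split=> [|x|p' Ap' x]; last exact: infle.
  split=> [x y|t x].
    apply: le_inf_sum => // _ _ [p1 Ap1 <-] [p2 Ap2 <-].
    have [le12|le21] := Atot _ _ Ap1 Ap2.
      apply: le_trans (infle _ _ Ap1) _; apply: le_trans ((Aq _ Ap1).1.1 _ _) _.
      by rewrite lerD2l.
    apply: le_trans (infle _ _ Ap2) _; apply: le_trans ((Aq _ Ap2).1.1 _ _) _.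
    by rewrite lerD2r.
  rewrite le_eqVlt => /predU1P[<-|t0].
    rewrite scale0r mul0r; apply: le_trans (infle _ _ Ap0) _.
    by rewrite sublinear0//; exact: (Aq _ Ap0).1.
  rewrite -ler_pdivrMl//; apply: lb_le_inf => // _ [p Ap <-].
  rewrite ler_pdivrMl//; apply: le_trans (infle _ _ Ap) _.
  by apply: (Aq _ Ap).1.2; exact: ltW.
by apply: le_trans (infle _ _ Ap0) _; exact: (Aq _ Ap0).2.
Qed.

(* A minimal sublinear functional [p] is odd, hence linear: it coincides with
   [y |-> inf_(s >= 0) (p (y + s x) - s p x)], whose value at [- x] is at most
   [- p x]. *)
Theorem hahn_banach q : sublinear q ->
  exists l : U -> R, (forall t x y, l (t *: x + y) = t * l x + l y) /\
    forall x, l x <= q x.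
Proof.
move=> sq; pose S := {p : U -> R | sublinear p /\ forall x, p x <= q x}.
(* The order is reversed: the maximal element of Zorn's lemma is a minimal functional. *)
pose le (s1 s2 : S) := `[< forall x, sval s2 x <= sval s1 x >].
have [| | | |[p [sp pq]] pmin] := @Zorn S le.
- by move=> s; apply/asboolP.
- move=> s1 s2 s3 /asboolP h12 /asboolP h23; apply/asboolP => x.
  exact: le_trans (h23 x) (h12 x).
- move=> [p1 h1] [p2 h2] /asboolP /= h12 /asboolP /= h21; apply: eq_exist.
  by apply/funext => x; apply/le_anti; rewrite h12 h21.
- move=> A Atot; have [[s0 As0]|A0] := pselect (A !=set0); last first.
    exists (exist _ q (conj sq (fun x => lexx _))) => s As.
    by exfalso; apply: A0; exists s.
  have [||_ _ [s1 As1 <-] [s2 As2 <-]|p [sp pq pA]] :=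
      @sublinear_inf_chain q [set sval s | s in A] sq.
  + by exists (sval s0), s0.
  + by move=> _ [s As <-]; exact: (svalP s).
  + by have [/asboolP|/asboolP] := Atot _ _ As1 As2; [right|left].
  + exists (exist _ p (conj sp pq)) => s As; apply/asboolP => x /=.
    by apply: pA; exists s.
have p_odd x : p (- x) = - p x.
  apply/le_anti; rewrite -[leLHS]opprK -[p x in X in _ && X]opprK.
  rewrite [X in _ && X](_ : _ = true) ?andbT; last first.
    by rewrite opprK lerNl sublinear_ge.
  rewrite opprK; pose v y := [set p (y + s *: x) - s * p x | s in [set s : R | 0 <= s]].
  have v0 y : v y !=set0 by exists (p (y + 0 *: x) - 0 * p x), 0 => /=.
  have vge y b : v y b -> - p (- y) <= b.
    move=> [s /= s0 <-]; rewrite lerBrDl lerBlDr -sublinearZ//.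
    by rewrite -{1}(addKr y (s *: x)) addrC sp.1.
  have vle y s : 0 <= s -> inf (v y) <= p (y + s *: x) - s * p x.
    by move=> s0; apply: inf_le_lbound (vge y) _; exists s.
  pose p' y := inf (v y).
  have p'p y : p' y <= p y.
    by have := vle y 0 (lexx _); rewrite scale0r addr0 mul0r subr0.
  have sp' : sublinear p'.
    split=> [y z|t y].
      apply: le_inf_sum => // _ _ [s1 /= s10 <-] [s2 /= s20 <-].
      apply: le_trans (vle _ (s1 + s2) (addr_ge0 s10 s20)) _.
      have := sp.1 (y + s1 *: x) (z + s2 *: x).
      by rewrite addrACA -scalerDl mulrDl; lra.
    rewrite le_eqVlt => /predU1P[<-|t0].
      by rewrite scale0r mul0r; apply: le_trans (p'p _) _; rewrite sublinear0.
    rewrite -ler_pdivrMl//; apply: lb_le_inf => // _ [s /= s0 <-].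
    rewrite ler_pdivrMl// mulrBr -(@sublinearZ p t _ sp (ltW t0)) mulrA scalerDr scalerA.
    by apply: vle; rewrite mulr_ge0// ltW.
  have p'q y : p' y <= q y := le_trans (p'p y) (pq y).
  have := pmin (exist _ p' (conj sp' p'q)); rewrite /le /=.
  move=> /(_ (introT (asboolP _) p'p)) [pE].
  have := vle (- x) 1 ler01; rewrite -/(p' (- x)) -pE.
  by rewrite scale1r addNr sublinear0// mul1r add0r.
have pZ t x : p (t *: x) = t * p x.
  have [t0|t0] := lerP 0 t; first exact: sublinearZ.
  rewrite -[LHS]opprK -p_odd -scaleNr sublinearZ// ?mulNr ?opprK//.
  by rewrite oppr_ge0 ltW.
exists p; split=> // t x y; rewrite -pZ; apply/le_anti; rewrite sp.1 /=.
have := sp.1 (- (t *: x)) (- y); rewrite -opprD !p_odd; lra.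
Qed.

End hahn_banach.

(** * Positive functionals on bounded functions *)

Section bounded_functions.
Context (X : choiceType) (R : realType).

(** Bounded functions are dominated by multiples of a function [w >= 1], which keeps the infimum in
    [positive_extension] finite. *)
Definition bounded_function : {pred X -> R} :=
  fun f => `[< exists M : R, forall x, `|f x| <= M >].

Lemma bounded_function_submod : submod_closed bounded_function.
Proof.
split=> [|a f g /asboolP[M fM] /asboolP[N gN]]; apply/asboolP.
  by exists 0 => x; rewrite normr0.
exists (`|a| * M + N) => x; apply: le_trans (ler_normD _ _) _.
by rewrite lerD ?gN//= normrM ler_wpM2l.
Qed.

HB.instance Definition _ :=
  GRing.isSubmodClosed.Build R (X -> R) bounded_function bounded_function_submod.

Record bfun := Bfun { bfun_val :> X -> R ; _ : bfun_val \in bounded_function }.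

HB.instance Definition _ := [isSub for bfun_val].
HB.instance Definition _ := [Choice of bfun by <:].
HB.instance Definition _ := [SubChoice_isSubLmodule of bfun by <:].

Lemma bfunP (u : bfun) : exists M : R, forall x, `|u x| <= M.
Proof. by case: u => u /= /asboolP. Qed.

(* Positive functionals on a cofinal space extend: Hahn-Banach for
   [q u = inf {l | G g l, u <= g}]. *)
Lemma positive_extension (G : (X -> R) -> R -> Prop) :
  (forall t f l g m, G f l -> G g m -> G (fun z => t * f z + g z) (t * l + m)) ->
  (forall f l, G f l -> (forall z, 0 <= f z) -> 0 <= l) ->
  (exists w l, G w l /\ forall z, 1 <= w z) ->
  exists L : bfun -> R, (forall t (u v : bfun), L (t *: u + v) = t * L u + L v) /\
    forall (u : bfun) g l, G g l -> (forall z, u z <= g z) -> L u <= l.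
Proof.
move=> Glin Gpos [w [lw [Gw w1]]].
have G0 : G (fun=> 0) 0.
  have := Glin (-1) _ _ _ _ Gw Gw; rewrite mulN1r addNr.
  by congr G; apply/funext => z; rewrite mulN1r addNr.
have GD f l g m : G f l -> G g m -> G (fun z => f z + g z) (l + m).
  move=> Gf Gg; have := Glin 1 _ _ _ _ Gf Gg; rewrite mul1r.
  by congr G; apply/funext => z; rewrite mul1r.
have GZ t f l : G f l -> G (fun z => t * f z) (t * l).
  move=> Gf; have := Glin t _ _ _ _ Gf G0; rewrite addr0.
  by congr G; apply/funext => z; rewrite addr0.
pose V (u : bfun) := [set l : R | exists g, G g l /\ forall z, u z <= g z].
have V0 u : V u !=set0.
  have [M uM] := bfunP u; exists (`|M| * lw), (fun z => `|M| * w z).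
  split=> [|z]; first exact: GZ.
  apply: le_trans (ler_norm _) _; apply: le_trans (uM z) _.
  by apply: le_trans (ler_norm _) _; rewrite ler_peMr.
(* If [u <= g] and [|u| <= M], then [g + |M| w >= 0], so positivity bounds [l] from below. *)
have Vge u : exists m, forall l, V u l -> m <= l.
  have [M uM] := bfunP u; exists (- (`|M| * lw)) => l [g [Gg ug]].
  rewrite -subr_ge0 opprK; apply: Gpos (GD _ _ _ _ Gg (GZ `|M| _ _ Gw)) _ => z.
  rewrite -lerBlDr sub0r; apply: le_trans (ug z); rewrite lerNl.
  apply: le_trans (ler_norm _) _; rewrite normrN; apply: le_trans (uM z) _.
  by apply: le_trans (ler_norm _) _; rewrite ler_peMr.
have infle u l : V u l -> inf (V u) <= l.
  by have [m mV] := Vge u; exact: inf_le_lbound mV.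
have subq : sublinear (fun u : bfun => inf (V u)).
  split=> [u v|t u].
    apply: le_inf_sum => // a b [g [Gg ug]] [h [Gh vh]]; apply: infle.
    exists (fun z => g z + h z); split; first exact: GD.
    by move=> z; rewrite lerD.
  rewrite le_eqVlt => /predU1P[<-|t0].
    by rewrite scale0r mul0r; apply: infle; exists (fun=> 0).
  rewrite -ler_pdivrMl//; apply: lb_le_inf => // l [g [Gg ug]].
  rewrite ler_pdivrMl//; apply: infle; exists (fun z => t * g z).
  by split=> [|z]; [exact: GZ|rewrite ler_pM2l].
have [L [Llin Lq]] := hahn_banach subq.
exists L; split=> // u g l Gg ug; apply: le_trans (Lq u) _.
by apply: infle; exists g.
Qed.

End bounded_functions.

(** * Digit expansions *)

Section expansions.
Context {R : realType}.
Implicit Types (t : R) (j : int) (n m i : nat).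

(** With partial sums [P n], the intervals [[P n + lo b^-n, P n + hi b^-n]] are nested by the bounds
    on the digits; [S] is the supremum of their left ends. *)
Lemma expansion (b lo hi : R) (d : nat -> R) : 1 < b ->
  (forall i, lo * (b - 1) <= d i <= hi * (b - 1)) ->
  exists S, forall n, lo * b ^- n <= S - \sum_(i < n) d i * b ^- i.+1 <= hi * b ^- n.
Proof.
move=> b1 dlh; have b0 : 0 < b by lra.
pose P n := \sum_(i < n) d i * b ^- i.+1.
have bn n : 0 < b ^- n.+1 by rewrite invr_gt0 exprn_gt0.
have bS n : b ^- n = b * b ^- n.+1 by rewrite exprS invfM mulrA divff ?mul1r ?lt0r_neq0.
have PS n : P n.+1 = P n + d n * b ^- n.+1 by rewrite /P big_ord_recr.
have Lhomo : {homo (fun n => P n + lo * b ^- n) : m n / (m <= n)%N >-> m <= n}.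
  apply: homo_leq => [x //|y x z|n]; first exact: le_trans.
  rewrite PS bS -subr_ge0; have /andP[l _] := dlh n.
  rewrite [leRHS](_ : _ = (d n - lo * (b - 1)) * b ^- n.+1); last by ring.
  by rewrite mulr_ge0 ?subr_ge0// ltW.
have Uhomo : {homo (fun n => - (P n + hi * b ^- n)) : m n / (m <= n)%N >-> m <= n}.
  apply: homo_leq => [x //|y x z|n]; first exact: le_trans.
  rewrite PS bS -subr_ge0; have /andP[_ h] := dlh n.
  rewrite [leRHS](_ : _ = (hi * (b - 1) - d n) * b ^- n.+1); last by ring.
  by rewrite mulr_ge0 ?subr_ge0// ltW.
have lohi : lo <= hi.
  have /andP[l h] := dlh 0%N; have := le_trans l h.
  by rewrite ler_pM2r// subr_gt0.
have LU m n : P m + lo * b ^- m <= P n + hi * b ^- n.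
  apply: le_trans (Lhomo _ _ (leq_maxl m n)) _.
  have := Uhomo _ _ (leq_maxr m n); rewrite lerN2; apply: le_trans.
  by rewrite lerD2l ler_wpM2r// invr_ge0 exprn_ge0// ltW.
have Lsup : has_sup (range (fun n => P n + lo * b ^- n)).
  split; first by exists (P 0%N + lo * b ^- 0), 0%N.
  by exists (P 0%N + hi * b ^- 0) => _ [n _ <-].
exists (sup (range (fun n => P n + lo * b ^- n))) => n; apply/andP; split.
  rewrite lerBrDl; apply: sup_upper_bound => //; by exists n.
by rewrite lerBlDl; apply: ge_sup => [|_ [m _ <-]]; [case: Lsup|exact: LU].
Qed.

Lemma ex_lt_pow2 (x : R) : exists n, x < 2 ^+ n.
Proof.
exists (Num.bound `|x|); apply: le_lt_trans (ler_norm x) _.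
apply: lt_trans (archi_boundP (normr_ge0 x)) _.
by rewrite -natrX ltr_nat ltn_expl.
Qed.

Lemma eq_of_pow2_bound (x y a : R) : 0 <= a ->
  (forall n, `|x - y| <= a * 2 ^- n) -> x = y.
Proof.
move=> a0 xy; apply/eqP; rewrite -subr_eq0 -normr_le0 leNgt; apply/negP => xy0.
have [n] := ex_lt_pow2 (a / `|x - y|).
rewrite ltr_pdivrMr// -ltr_pdivrMl ?exprn_gt0// mulrC.
by rewrite ltNge xy.
Qed.

Lemma binary_expansion (d : nat -> bool) : exists S : R, forall n,
  0 <= S - \sum_(i < n) (d i)%:R * 2 ^- i.+1 <= 2 ^- n.
Proof.
have [|i|S SP] := @expansion 2 0 1 (fun i => (d i)%:R); first lra.
  by case: (d i) => /=; apply/andP; split; lra.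
by exists S => n; have := SP n; rewrite mul0r mul1r.
Qed.

Definition binary (d : nat -> bool) : R := sval (cid (binary_expansion d)).

Lemma binaryP d n : 0 <= binary d - \sum_(i < n) (d i)%:R * 2 ^- i.+1 <= 2 ^- n.
Proof. exact: (svalP (cid (binary_expansion d))). Qed.

Lemma binary_itv d : 0 <= binary d <= 1.
Proof. by have := binaryP d 0; rewrite big_ord0 subr0 expr0 invr1. Qed.

Lemma binary_near d d' n : (forall i, (i < n)%N -> d i = d' i) ->
  `|binary d - binary d'| <= 2 ^- n.
Proof.
move=> dd'; have := binaryP d n; have := binaryP d' n.
rewrite (eq_bigr (fun i : 'I_n => (d i)%:R * 2 ^- i.+1)) => [|i _]; last first.
  by rewrite dd'.
move: (\sum_(i < n) _) => s; rewrite ler_norml => /andP[a1 a2] /andP[b1 b2].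
apply/andP; split; lra.
Qed.

(** The bits come from the doubling map: the iterate [t n] is the remainder of [x] after [n] bits,
    scaled by [2 ^ n]. *)
Lemma binary_surj x : 0 <= x <= 1 -> exists d, binary d = x.
Proof.
move=> x01; pose t n := iter n (fun t => 2 * t - (2^-1 <= t)%R%:R) x.
have t01 n : 0 <= t n <= 1.
  elim: n => // n /=; move: (t n) => s /andP[s0 s1].
  by have [h|h] := lerP 2^-1 s; apply/andP; split; rewrite /=; lra.
exists (fun n => 2^-1 <= t n); apply: (@eq_of_pow2_bound _ _ 1) => // n.
have xE : x = \sum_(i < n) (2^-1 <= t i)%R%:R * 2 ^- i.+1 + t n * 2 ^- n.
  elim: n => [|n IHn]; first by rewrite big_ord0 add0r expr0 invr1 mulr1.
  rewrite {1}IHn big_ord_recr/= -addrA; congr (_ + _).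
  rewrite -/(t n) exprS invfM; field; rewrite expf_neq0//; lra.
have := binaryP (fun n => 2^-1 <= t n) n.
have /andP[tn0 tn1] := t01 n.
have en : 0 <= (2 : R) ^- n by rewrite invr_ge0 exprn_ge0.
have tn : t n * 2 ^- n <= 2 ^- n by rewrite ler_piMl.
have tn' : 0 <= t n * 2 ^- n by rewrite mulr_ge0.
move: xE tn tn'; rewrite mul1r ler_norml; move: (t n * _) (\sum_(i < n) _) => u s.
by move=> xE u1 u0 /andP[h1 h2]; apply/andP; split; lra.
Qed.

(** Cells are open on the left and closed on the right, like the intervals on which a Stieltjes
    measure is given; hence the ceiling. *)
Definition cell n t : int := Num.ceil (6 ^+ n * t) - 1.

Lemma cellP n t j : cell n t = j <-> j%:~R < 6 ^+ n * t <= j%:~R + 1.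
Proof.
have j1 : (j + 1)%:~R = j%:~R + 1 :> R by rewrite rmorphD.
split=> [<-|/andP[h1 h2]].
  by rewrite -[X in _ <= _ + X](rmorph1 intr) -rmorphD /cell subrK ceil_ge ceilB1_lt.
move: h1 h2; rewrite -ceil_gt_int -j1 -ceil_le_int /cell.
by move: (Num.ceil _) => e h1 h2; apply/eqP; rewrite subr_eq eq_le h2 -ltzD1 ltrD2r.
Qed.

Lemma cell_itv n t : (cell n t)%:~R < 6 ^+ n * t <= (cell n t)%:~R + 1.
Proof. exact/cellP. Qed.

Lemma cellS n t : 6 * cell n t <= cell n.+1 t < 6 * cell n t + 6.
Proof.
have := cell_itv n t; have := cell_itv n.+1 t; rewrite exprS -mulrA.
move: (6 ^+ n * t) (cell n t) (cell n.+1 t) => s j k /andP[a b] /andP[c d].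
apply/andP; split.
  by rewrite -ltzD1 -(ltr_int R) intrD intrM; lra.
by rewrite -(ltr_int R) intrD intrM; lra.
Qed.

Lemma cell_nest m n t t' : (m <= n)%N -> cell n t = cell n t' -> cell m t = cell m t'.
Proof.
elim: n => [|n IHn]; first by rewrite leqn0 => /eqP->.
rewrite leq_eqVlt => /predU1P[->//|]; rewrite ltnS => mn tt'; apply: IHn => //.
have := cellS n t; have := cellS n t'; rewrite tt'; lia.
Qed.

Definition digit n t : int := cell n.+1 t - 6 * cell n t.

Lemma digit_eq n m t t' : (m < n)%N -> cell n t = cell n t' -> digit m t = digit m t'.
Proof.
move=> mn tt'; rewrite /digit (@cell_nest m.+1 n t t')// (@cell_nest m n t t')//.
exact: ltnW.
Qed.

(* The digits 1, 2, 3, 4 stand for the pairs of bits (0,0), (1,0), (0,1), (1,1).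
   The digits 0 and 5 are never produced by the section of the curve, which
   therefore keeps away from the end points of the cells. *)
Definition curve_x t := binary (fun n => (digit n t == 2) || (digit n t == 4)).
Definition curve_y t := binary (fun n => (digit n t == 3) || (digit n t == 4)).

Lemma curve_xy_surj j (x y : R) : 0 <= x <= 1 -> 0 <= y <= 1 -> exists t,
  [/\ cell 0 t = j, curve_x t = x, curve_y t = y &
    forall n, (cell n t)%:~R + 5^-1 <= 6 ^+ n * t <= (cell n t)%:~R + 4 * 5^-1].
Proof.
move=> /binary_surj[b1 b1x] /binary_surj[b2 b2y].
(* The digits lie in [1..4]; [5^-1] and [4 * 5^-1] are the values of the base 6 expansions with all
   digits [1] and all digits [4]. *)
pose d n : int := (1 + b1 n + b2 n * 2)%N.
have [|i|S SP] := @expansion 6 5^-1 (4 * 5^-1) (fun i => (d i)%:~R).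
- by lra.
- by rewrite /d; case: (b1 i); case: (b2 i) => /=; apply/andP; split; lra.
(* [I n] is the index of the cell of level [n]: the remainder, between [1/5] and [4/5], stays
   strictly inside it. *)
pose I n : int := j * 6 ^+ n + \sum_(i < n) d i * 6 ^+ (n - i.+1).
have IE n : (I n)%:~R + 5^-1 <= 6 ^+ n * (j%:~R + S) <= (I n)%:~R + 4 * 5^-1.
  have c0 : (6 : R) ^+ n != 0 by rewrite expf_neq0//; lra.
  have -> : (I n)%:~R = 6 ^+ n * (j%:~R + \sum_(i < n) (d i)%:~R * 6 ^- i.+1) :> R.
    rewrite rmorphD rmorphM/= rmorphXn/= mulrDr mulrC; congr (_ + _).
    rewrite rmorph_sum mulr_sumr; apply: eq_bigr => i _ /=.
    rewrite rmorphM rmorphXn/= mulrCA; congr (_ * _).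
    by rewrite expfB_cond// pnatr_eq0 add0n.
  have c1 : 0 < (6 : R) ^+ n by rewrite exprn_gt0.
  have := SP n; rewrite ler_pdivrMr// ler_pdivlMr//.
  move: (\sum_(i < n) _) => s /andP[h1 h2].
  have -> : 6 ^+ n * (j%:~R + S) = 6 ^+ n * (j%:~R + s) + (S - s) * 6 ^+ n by ring.
  by rewrite !lerD2l h1.
exists (j%:~R + S).
have cellE n : cell n (j%:~R + S) = I n.
  by apply/cellP; have /andP[h1 h2] := IE n; apply/andP; split; lra.
have digitE n : digit n (j%:~R + S) = d n.
  rewrite /digit !cellE /I big_ord_recr subnn expr0 mulr1 addrA.
  rewrite [X in X - _](_ : _ = 6 * (j * 6 ^+ n + \sum_(i < n) d i * 6 ^+ (n - i.+1)) + d n).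
    by rewrite addrC addKr.
  rewrite mulrDr mulr_sumr exprS mulrCA; congr (_ + _ + _).
  apply: eq_bigr => i _; rewrite [RHS]mulrCA -exprS; congr (_ * _ ^+ _).
  by rewrite subnSK.
split.
- by rewrite cellE /I big_ord0 expr0 mulr1 addr0.
- rewrite -b1x; congr binary; apply/funext => n; rewrite digitE /d.
  by case: (b1 n); case: (b2 n).
- rewrite -b2y; congr binary; apply/funext => n; rewrite digitE /d.
  by case: (b1 n); case: (b2 n).
- by move=> n; rewrite cellE.
Qed.
End expansions.

(** * The curve *)

Section curve.
Context {R : realType}.
Local Notation C := R[i].
Implicit Types (t x y : R) (j : int).

Lemma exists_pow2 (M : R) : 0 < M -> exists a : int, 2 ^ a <= M < 2 ^ (a + 1).
Proof.
have ge1 (N : R) : 1 <= N -> exists n : nat, 2 ^+ n <= N < 2 ^+ n.+1.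
  move=> N1; case: (ex_minnP (ex_lt_pow2 N)) => -[|n] Nn nmin.
    by move: Nn; rewrite expr0 ltNge N1.
  exists n; rewrite Nn andbT leNgt; apply/negP => /nmin; by rewrite ltnn.
move=> M0; have [M1|M1] := lerP 1 M.
  have [n nM] := ge1 _ M1; exists n%:Z.
  by rewrite [n%:Z + 1]addrC -intS -!exprnP.
have [|n /andP[n1 n2]] := ge1 M^-1; first by rewrite -invr1 lef_pV2 ?posrE// ltW.
have p0 k : 0 < (2 : R) ^+ k by rewrite exprn_gt0.
have M2 : M <= 2 ^- n by rewrite -[M]invrK lef_pV2 ?posrE// invr_gt0.
have M3 : 2 ^- n.+1 < M by rewrite -[ltRHS]invrK ltf_pV2 ?posrE// invr_gt0.
(* Inversion moves the closed end of the dyadic interval to the right, so an exact power of two is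
   treated apart. *)
have [ME|MN] := eqVneq M (2 ^- n).
  exists (- n%:Z); rewrite -exprnN ME lexx/=.
  by rewrite expfzDr// -exprnN expr1z ltr_pMr ?ltr1n// invr_gt0.
exists (- n.+1%:Z); rewrite -exprnN (ltW M3)/= intS opprD addrAC addNr add0r.
rewrite -exprnN.
by rewrite lt_neqAle MN.
Qed.

(* If [j = 4 a + k], the point is obtained by rotating with ['i ^ k] a point of
   the trapezoid [2^a <= Re w <= 2^(a+1), |Im w| <= Re w]. *)
Definition point j x y : C :=
  'i ^ j * (2 ^ (j %/ 4)%Z * (1 + x))%:C%C * Complex 1 (2 * y - 1).

Lemma norm_point_factor (v : R) : `|v| <= 1 ->
  1 <= `|Complex 1 v : C| <= 2%:C%C.
Proof.
move=> v1; apply/andP; split.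
  by apply: le_trans (normc_ge_Re _); rewrite /= normr1.
rewrite [Complex 1 v]complexE/=; apply: le_trans (ler_normD _ _) _.
rewrite complexiE normrM normCi mul1r rmorph_nat.
rewrite -[2%:R]/(1 + 1) lerD//; first by rewrite rmorph1 normr1.
by rewrite normc_def/= expr0n addr0 sqrtr_sqr lecR.
Qed.

Lemma norm_i_exprz j : `|'i ^ j : C| = 1.
Proof.
case: j => n; first by rewrite -exprnP normrX normCi expr1n.
by rewrite NegzE -exprnN normfV normrX normCi expr1n invr1.
Qed.

Lemma norm_point j x y : 0 <= x <= 1 -> 0 <= y <= 1 ->
  (2 ^ (j %/ 4)%Z)%:C%C <= `|point j x y| <= (4 * 2 ^ (j %/ 4)%Z)%:C%C.
Proof.
move=> /andP[x0 x1] /andP[y0 y1]; rewrite /point; set a := 2 ^ _.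
have a0 : 0 < a by rewrite exprz_gt0.
have i1 := norm_i_exprz j.
have ax0 : 0 <= a * (1 + x) by rewrite mulr_ge0 ?addr_ge0// ltW.
rewrite !normrM i1 mul1r ger0_norm ?ler0c//.
have /andP[w1 w2] : 1 <= `|Complex 1 (2 * y - 1) : C| <= 2%:C%C.
  by apply: norm_point_factor; rewrite ler_norml; apply/andP; split; lra.
apply/andP; split.
  rewrite -[leLHS]mulr1; apply: ler_pM => //; rewrite ?ler0c ?lecR ?(ltW a0)//.
  by rewrite ler_peMr ?(ltW a0)// lerDl.
(* One factor [2] bounds [1 + x], the other the modulus of [1 + (2 y - 1) i]. *)
rewrite (_ : 4 * a = (a * 2) * 2); last by ring.
rewrite [leRHS]rmorphM; apply: ler_pM => //; rewrite ?ler0c ?lecR//.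
by rewrite ler_pM2l//; lra.
Qed.

Lemma point_neq0 j x y : 0 <= x <= 1 -> 0 <= y <= 1 -> point j x y != 0.
Proof.
move=> x01 y01; rewrite -normr_gt0; have /andP[+ _] := norm_point j x01 y01.
by apply: lt_le_trans; rewrite ltcR exprz_gt0.
Qed.

Lemma point_near j x y x' y' (e : R) :
  0 <= x' <= 1 -> 0 <= y <= 1 -> `|x - x'| <= e -> `|y - y'| <= e ->
  `|point j x y - point j x' y'| <= (6 * 2 ^ (j %/ 4)%Z * e)%:C%C.
Proof.
move=> /andP[x0 x1] /andP[y0 y1] xx' yy'; rewrite /point; set a := 2 ^ _.
have a0 : 0 < a by rewrite exprz_gt0.
have i1 := norm_i_exprz j.
have -> : 'i ^ j * (a * (1 + x))%:C%C * Complex 1 (2 * y - 1) -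
    'i ^ j * (a * (1 + x'))%:C%C * Complex 1 (2 * y' - 1) =
    'i ^ j * a%:C%C * ((x - x')%:C%C * Complex 1 (2 * y - 1) +
      (2 * (1 + x') * (y - y'))%:C%C * 'i).
  rewrite -complexiE (complexE (Complex _ (2 * y - 1))).
  rewrite (complexE (Complex _ (2 * y' - 1))) /= !rmorphM !rmorphB !rmorphD.
  by rewrite !rmorphM/=; ring.
have aC0 : 0 < a%:C%C :> C by rewrite ltcR.
rewrite !normrM i1 mul1r (ger0_norm (ltW aC0)).
(* The variation in [x] is multiplied by a factor of modulus at most [2], the one in [y] by
   [2 (1 + x') <= 4]. *)
rewrite (_ : 6 * a * e = a * (e * 2 + 4 * e)); last by ring.
rewrite [leRHS]rmorphM (ler_pM2l aC0); apply: le_trans (ler_normD _ _) _.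
rewrite [leRHS]rmorphD lerD// normrM.
  rewrite [leRHS]rmorphM ler_pM//.
    by rewrite normc_def/= expr0n addr0 sqrtr_sqr lecR.
  have /andP[//] : 1 <= `|Complex 1 (2 * y - 1) : C| <= 2%:C%C.
  by apply: norm_point_factor; rewrite ler_norml; apply/andP; split; lra.
rewrite normCi mulr1 normc_def/= expr0n addr0 sqrtr_sqr lecR normrM.
rewrite ler_pM// ger0_norm//; lra.
Qed.

(** Comparing [|Re z|] with [|Im z|], and then a sign, selects the quarter turn that brings [z] into
    the sector [|Im w| <= Re w]. There [a] is the dyadic exponent of [u = Re w], and [x], [y] solve
    [u = 2^a (1 + x)] and [v / u = 2 y - 1]. *)
Lemma point_surj (z : C) : z != 0 -> exists j x y,
  [/\ 0 <= x <= 1, 0 <= y <= 1 & point j x y = z].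
Proof.
move=> z0; have [k [w [k03 zE w0 wI]]] : exists k w, [/\ 0 <= k < 4,
    z = 'i ^ k * w, 0 < complex.Re w & `|complex.Im w| <= complex.Re w].
  move: z z0 => [a b]; rewrite eq_complex /= negb_and => ab0.
  have i2 : ('i : C) ^ (2 : int) = -1 by rewrite -exprnP sqrCi.
  have i3 : ('i : C) ^ (3 : int) = - 'i by rewrite -exprnP exprS sqrCi mulrN1.
  have pos (c d : R) : `|d| <= c -> (a == 0) && (b == 0) = (c == 0) && (d == 0) -> 0 < c.
    move=> dc abcd; rewrite lt_neqAle (le_trans (normr_ge0 d) dc) andbT eq_sym.
    move: ab0; rewrite -negb_and abcd; apply: contraNneq => c0.
    by move: dc; rewrite c0 normr_le0 => ->; rewrite eqxx.
  have [ba|ab] := lerP `|b| `|a|; have [s0|s0] := lerP 0 (if `|b| <= `|a| then a else b).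
  - exists 0, (Complex a b); rewrite expr0z mul1r /=.
    move: s0; rewrite ba => s0; rewrite (ger0_norm s0) in ba.
    by split=> //; apply: pos ba _.
  - exists 2, (Complex (- a) (- b)); rewrite i2 /=.
    move: s0; rewrite ba => s0; rewrite (ltr0_norm s0) in ba.
    split=> //; first by rewrite mulN1r; simpc; rewrite ?opprK.
      by apply: (@pos _ (- b)); rewrite ?normrN// !oppr_eq0.
    by rewrite normrN.
  - exists 1, (Complex b (- a)); rewrite expr1z /=.
    move: s0; rewrite (lt_geF ab) => s0; rewrite (ger0_norm s0) in ab.
    split=> //; first by rewrite -complexiE; simpc; rewrite ?opprK.
      by apply: (@pos _ (- a)); rewrite ?normrN 1?ltW// oppr_eq0 andbC.
    by rewrite normrN ltW.
  - exists 3, (Complex (- b) a); rewrite i3 /=.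
    move: s0; rewrite (lt_geF ab) => s0; rewrite (ltr0_norm s0) in ab.
    split=> //; first by rewrite -complexiE; simpc; rewrite ?opprK.
      by apply: (@pos _ a); rewrite 1?ltW// oppr_eq0 andbC.
    by rewrite ltW.
have [a /andP[a1 a2]] := exists_pow2 w0.
have a0 : 0 < (2 : R) ^ a by rewrite exprz_gt0.
move: w {z0} zE w0 wI a1 a2 => [u v] /= -> u0 vu a1 a2.
exists (4 * a + k), (u / 2 ^ a - 1), ((v / u + 1) / 2); split.
- rewrite subr_ge0 ler_pdivlMr// mul1r a1 lerBlDr ler_pdivrMr//.
  by move: a2; rewrite expfzDr// expr1z mulrC => /ltW.
- move: vu; rewrite ler_norml => /andP[v1 v2].
  have : -1 <= v / u <= 1 by rewrite ler_pdivlMr// ler_pdivrMr// mulN1r mul1r v1.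
  by move=> /andP[h1 h2]; apply/andP; split; lra.
rewrite /point (_ : (_ %/ 4)%Z = a); last first.
  by rewrite mulrC divzMDl// divz_small ?addr0//; case/andP: k03 => -> /=.
have -> : ('i : C) ^ (4 * a + k) = 'i ^ k.
  rewrite expfzDr ?neq0Ci// -exprz_exp -[X in X ^ a](_ : 'i ^+ 4 = _)//.
  by rewrite (exprM _ 2 2) sqrCi sqrrN expr1n exp1rz mul1r.
rewrite -mulrA; congr (_ * _).
rewrite (_ : 2 ^ a * _ = u); last by field; rewrite lt0r_neq0.
rewrite (_ : 2 * _ - 1 = v / u); last by field; rewrite lt0r_neq0.
by simpc; rewrite mulrC divfK// lt0r_neq0.
Qed.

Lemma curve_subproof t :
  point (cell 0 t) (curve_x t) (curve_y t) \in [set z : R[i]^o | z != 0].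
Proof. by apply/mem_set/point_neq0; exact: binary_itv. Qed.

Definition curve t : Cstar R :=
  exist (fun z => z \in [set z : R[i]^o | z != 0]) _ (curve_subproof t).

Lemma norm_curve t :
  (2 ^ (cell 0 t %/ 4)%Z)%:C%C <= `|Cval (curve t)| <= (4 * 2 ^ (cell 0 t %/ 4)%Z)%:C%C.
Proof. by apply: norm_point; exact: binary_itv. Qed.

Lemma curve_near n t t' : cell n t = cell n t' ->
  `|Cval (curve t) - Cval (curve t')| <= (6 * 2 ^ (cell 0 t %/ 4)%Z * 2 ^- n)%:C%C.
Proof.
move=> tt'; rewrite /Cval /= -(@cell_nest _ 0 n t t' _ tt')//.
apply: point_near; rewrite ?binary_itv//; apply: binary_near => i ni;
  by rewrite (digit_eq ni tt').
Qed.

(** The preimages built by [curve_xy_surj] stay in the middle three fifths of their cell at every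
    level; [half_line_gap] rests on this gap. *)
Lemma curve_section : exists pos : Cstar R -> R, forall z,
  curve (pos z) = z /\ forall n,
    (cell n (pos z))%:~R + 5^-1 <= 6 ^+ n * pos z <= (cell n (pos z))%:~R + 4 * 5^-1.
Proof.
suff : forall z : Cstar R, exists t, curve t = z /\ forall n,
    (cell n t)%:~R + 5^-1 <= 6 ^+ n * t <= (cell n t)%:~R + 4 * 5^-1.
  by move=> /choice[pos posP]; exists pos.
move=> z; have [j [x [y [x01 y01 zE]]]] := point_surj (Cval_neq0 z).
have [t [tj tx ty tP]] := curve_xy_surj j x01 y01.
by exists t; split=> //; apply/val_inj; rewrite /= tj tx ty.
Qed.

(* Uniform continuity along the curve on every compact annulus. *)
Definition tame (g : Cstar R -> C) := forall J : nat,
  (exists B : R, 0 <= B /\ forall t, (`|cell 0 t| <= J)%N -> `|g (curve t)| <= B%:C%C) /\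
  (forall e : R, 0 < e -> exists n, forall t t', (`|cell 0 t| <= J)%N ->
     cell n t = cell n t' -> `|g (curve t) - g (curve t')| <= e%:C%C).

Lemma tame_cst a : tame (fun=> a).
Proof.
move=> J; split; last first.
  by move=> e e0; exists 0%N => t t' _ _; rewrite subrr normr0 ler0c ltW.
exists (complex.Re `|a|); rewrite -ler0c; have -> : (complex.Re `|a|)%:C%C = `|a|.
  exact/RRe_real/normr_real.
by split.
Qed.

Lemma tameD f g : tame f -> tame g -> tame (fun z => f z + g z).
Proof.
move=> tf tg J; have [[B1 [B10 fB]] ff] := tf J; have [[B2 [B20 gB]] gg] := tg J.
split.
  exists (B1 + B2); split; first exact: addr_ge0.
  by move=> t tJ; rewrite rmorphD; apply: le_trans (ler_normD _ _) _; rewrite lerD ?fB ?gB.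
move=> e e0; have e20 : 0 < e / 2 by rewrite divr_gt0.
have [n1 h1] := ff _ e20; have [n2 h2] := gg _ e20.
exists (maxn n1 n2) => t t' tJ tt'.
rewrite opprD addrACA [e]splitr rmorphD; apply: le_trans (ler_normD _ _) _.
by rewrite lerD ?h1 ?h2//; apply: cell_nest tt'; rewrite ?leq_maxl ?leq_maxr.
Qed.

Lemma tameM f g : tame f -> tame g -> tame (fun z => f z * g z).
Proof.
move=> tf tg J; have [[B1 [B10 fB]] ff] := tf J; have [[B2 [B20 gB]] gg] := tg J.
split.
  exists (B1 * B2); split; first exact: mulr_ge0.
  by move=> t tJ; rewrite rmorphM normrM ler_pM ?fB ?gB.
move=> e e0; pose D := B1 + B2 + 1.
have D0 : 0 < D by rewrite ltr_pwDr// addr_ge0.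
have eD0 : 0 < e / D by rewrite divr_gt0.
have [n1 h1] := ff _ eD0; have [n2 h2] := gg _ eD0.
exists (maxn n1 n2) => t t' tJ tt'.
have {}h1 : `|f (curve t) - f (curve t')| <= (e / D)%:C%C.
  by apply: h1 => //; apply: cell_nest tt'; rewrite leq_maxl.
have {}h2 : `|g (curve t) - g (curve t')| <= (e / D)%:C%C.
  by apply: h2 => //; apply: cell_nest tt'; rewrite leq_maxr.
have t'J : (`|cell 0 t'| <= J)%N by rewrite -(@cell_nest _ 0 _ _ _ _ tt').
rewrite (_ : _ - _ = f (curve t) * (g (curve t) - g (curve t')) +
  (f (curve t) - f (curve t')) * g (curve t')); last by ring.
apply: le_trans (ler_normD _ _) _; rewrite !normrM.
apply: (@le_trans _ _ (B1 * (e / D) + e / D * B2)%:C%C).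
  by rewrite rmorphD !rmorphM; apply: lerD; apply: ler_pM => //; rewrite ?fB ?gB// -rmorphM.
rewrite lecR (_ : _ + _ = e * ((B1 + B2) / D)); last by field; rewrite lt0r_neq0.
rewrite ler_piMr ?(ltW e0)// ler_pdivrMr// mul1r.
by rewrite /D lerDl.
Qed.

Lemma pow2_cell_le J t : (`|cell 0 t| <= J)%N ->
  2 ^ (cell 0 t %/ 4)%Z <= 2 ^+ J :> R /\ (2 ^ (cell 0 t %/ 4)%Z)^-1 <= 2 ^+ J :> R.
Proof.
move: (cell 0 t) => j jJ.
have hj : (`|(j %/ 4)%Z| <= J)%N by lia.
split; rewrite exprnP ?invr_expz; apply: ler_weXz2l; rewrite ?ler1n//; lia.
Qed.

Lemma tame_Cval : tame (@Cval R).
Proof.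
move=> J; split.
  exists (4 * 2 ^+ J); split; first by rewrite mulr_ge0// exprn_ge0.
  move=> t /pow2_cell_le[h _]; have /andP[_ /le_trans->//] := norm_curve t.
  by rewrite lecR ler_pM2l.
move=> e e0.
have [n] := ex_lt_pow2 (6 * 2 ^+ J / e).
rewrite ltr_pdivrMr// => hn; exists n => t t' /pow2_cell_le[h _] tt'.
apply: le_trans (curve_near tt') _; rewrite lecR ler_pdivrMr ?exprn_gt0//.
by rewrite [leRHS]mulrC; apply: le_trans (ltW hn); rewrite ler_pM2l.
Qed.

Lemma tame_inv : tame (fun z => (Cval z)^-1).
Proof.
have inv_le t : `|(Cval (curve t))^-1| <= (2 ^ (cell 0 t %/ 4)%Z)^-1%:C%C.
  have /andP[h _] := norm_curve t; rewrite normfV fmorphV lef_pV2 ?posrE//.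
    by rewrite normr_gt0 Cval_neq0.
  by rewrite ltcR exprz_gt0.
move=> J; split.
  exists (2 ^+ J); split=> [|t /pow2_cell_le[_ h]]; first exact: exprn_ge0.
  by apply: le_trans (inv_le t) _; rewrite lecR.
(* In [1/z - 1/z' = (z' - z) / (z z')] each inverse is bounded by [2 ^+ J]. *)
move=> e e0; have [_ /(_ (e / (2 ^+ J * 2 ^+ J)))] := tame_Cval J.
rewrite divr_gt0 ?mulr_gt0 ?exprn_gt0// => /(_ isT)[n h]; exists n => t t' tJ tt'.
have t'J : (`|cell 0 t'| <= J)%N by rewrite -(@cell_nest _ 0 _ _ _ _ tt').
have z0 := Cval_neq0 (curve t); have z'0 := Cval_neq0 (curve t').
rewrite -[X in `|X|](_ : (Cval (curve t') - Cval (curve t)) *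
  ((Cval (curve t))^-1 * (Cval (curve t'))^-1) = _); last by field; rewrite z0 z'0.
have le_pow s : (`|cell 0 s| <= J)%N -> `|(Cval (curve s))^-1| <= (2 ^+ J)%:C%C.
  move=> /pow2_cell_le[_ hs]; apply: le_trans (inv_le s) _; by rewrite lecR.
rewrite !normrM distrC [e](_ : _ = e / (2 ^+ J * 2 ^+ J) * (2 ^+ J * 2 ^+ J)).
  rewrite rmorphM [X in _ <= _ * X]rmorphM.
  by apply: ler_pM => //; [exact: h|apply: ler_pM => //; exact: le_pow].
by rewrite divfK// mulf_neq0 ?expf_neq0.
Qed.

Lemma tame_conj f : tame f -> tame (fun z => (f z)^*).
Proof.
move=> tf J; have [[B [B0 fB]] ff] := tf J; split.
  by exists B; split=> // t tJ; rewrite norm_conjC fB.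
move=> e /ff[n h]; exists n => t t' tJ tt'.
by rewrite -rmorphB norm_conjC h.
Qed.

Lemma tame_laurent f : laurent_fun f -> tame f.
Proof.
move=> /laurent_fun_seq[s [a fE]].
have -> : f = fun z => \sum_(k <- s) a k * monom k z by apply/funext.
elim: s {fE} => [|[m n] s IHs].
  by under [X in tame X]eq_fun do rewrite big_nil; exact: tame_cst.
have tX g (k : nat) : tame g -> tame (fun z => g z ^+ k).
  move=> tg; elim: k => [|k IHk].
    by under [X in tame X]eq_fun do rewrite expr0; exact: tame_cst.
  by under [X in tame X]eq_fun do rewrite exprS; exact: (tameM tg IHk).
have tXz k : tame (fun z => Cval z ^ k).
  case: k => k; first exact: (tX _ _ tame_Cval).
  have := tX _ k.+1 tame_inv; congr tame; apply/funext => z.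
  by rewrite NegzE -exprnN exprVn.
under [X in tame X]eq_fun do rewrite big_cons monomE -conjC_exprz.
apply: (@tameD (fun z => a (m, n) * (Cval z ^ m * (Cval z ^ n)^*))) IHs.
apply: (@tameM (fun=> a (m, n))) (tame_cst _) _.
exact: tameM (tXz m) (tame_conj (tXz n)).
Qed.

End curve.

(** * Measurability *)

Section borel.
Import numFieldNormedType.Exports.
Context {R : realType}.
Local Notation C := R[i].

Lemma continuous_Cval : continuous (@Cval R : Cstar R -> C^o).
Proof.
exact: (@initial_continuous _ _ (set_val : set_type [set z : C^o | z != 0] -> C^o)).
Qed.

(** Radii of balls in [C^o] are elements of [R[i]], and the positive ones are real; this lemma and
    its converse pass to radii in [R]. *)
Lemma nbhs_Rball (x : C^o) (A : set C^o) (e : R) : 0 < e ->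
  (forall y, `|x - y| < e%:C%C -> A y) -> nbhs x A.
Proof.
move=> e0 eA; apply/nbhs_ballP; exists e%:C%C; first by rewrite /= ltcR.
exact: eA.
Qed.

Lemma nbhs_RballP (x : C^o) (A : set C^o) : nbhs x A ->
  exists2 e : R, 0 < e & forall y, `|x - y| < e%:C%C -> A y.
Proof.
move=> /nbhs_ballP[[e ei]]; rewrite /= ltcE /= => /andP[/eqP -> e0] eA.
by exists e.
Qed.

Lemma continuous_Re : continuous (@complex.Re R : C^o -> R).
Proof.
move=> x A /nbhs_ballP[e e0 eA]; apply: (nbhs_Rball e0) => y xy; apply: eA.
rewrite /ball /= -ltcR; apply: le_lt_trans xy.
have ReB (u v : C) : complex.Re u - complex.Re v = complex.Re (u - v).
  by case: u v => ? ? [].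
by rewrite ReB; exact: normc_ge_Re.
Qed.

Lemma continuous_conjC : continuous (Num.conj : C^o -> C^o).
Proof.
move=> x A /nbhs_RballP[e e0 eA]; apply: (nbhs_Rball e0) => y xy.
by apply: eA; rewrite -rmorphB norm_conjC.
Qed.

Lemma continuous_exprz (g : Cstar R -> C^o) (n : int) :
  continuous g -> (forall z, g z != 0) -> continuous (fun z => g z ^ n : C^o).
Proof.
move=> cg g0.
have cX k : continuous (fun z => g z ^+ k : C^o).
  elim: k => [|k IHk] z; first exact: (@cst_continuous _ C^o 1).
  have -> : (fun z => g z ^+ k.+1 : C^o) = (fun z => g z * g z ^+ k).
    by apply/funext => w; rewrite exprS.
  exact: (cvgM (cg z) (IHk z)).
case: n => n z; first exact: cX.
exact: (@cvgV _ _ _ _ (fun z => g z ^+ n.+1 : C^o) _ (expf_neq0 _ (g0 z)) (cX n.+1 z)).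
Qed.

Lemma continuous_laurent (f : Cstar R -> C) :
  laurent_fun f -> continuous (f : Cstar R -> C^o).
Proof.
move=> /laurent_fun_seq[s [a fE]].
have -> : f = fun z => \sum_(k <- s) a k * monom k z by apply/funext.
elim: s {fE} => [|[m n] s IHs] z.
  have -> : (fun z => \sum_(k <- [::]) a k * monom k z) = cst 0.
    by apply/funext => w; rewrite big_nil.
  exact: (@cst_continuous _ C^o 0).
have -> : (fun z => \sum_(k <- (m, n) :: s) a k * monom k z) =
    (fun z => a (m, n) * (Cval z ^ m * (Cval z)^* ^ n) + \sum_(k <- s) a k * monom k z).
  by apply/funext => w; rewrite big_cons.
have cv := continuous_exprz (n := m) continuous_Cval (@Cval_neq0 R).
have cvJ : continuous (fun z => (Cval z)^* : C^o).
  move=> w; apply: (@continuous_comp _ _ _ (@Cval R : Cstar R -> C^o)).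
    exact: continuous_Cval.
  exact: continuous_conjC.
have vJ0 w : (Cval w)^* != 0 :> C by rewrite conjC_eq0 Cval_neq0.
have cvJn := continuous_exprz (n := n) cvJ vJ0.
have cc := @cst_continuous (Cstar R) C^o (a (m, n)) z.
exact: (cvgD (cvgM cc (cvgM (cv z) (cvJn z))) (IHs z)).
Qed.

Lemma measurable_Re_laurent (f : Cstar R -> C) : laurent_fun f ->
  measurable_fun setT (fun z : Cstar_borel R => complex.Re (f z)).
Proof.
move=> fL; apply: (@measurability _ _ _ _ _ _ (@RGenOpens.G R)).
  exact: RGenOpens.measurableE.
move=> _ [_ [x [y ->]] <-]; rewrite setTI; apply: sub_sigma_algebra.
have cf : continuous (fun z => complex.Re (f z)).
  move=> z; apply: (@continuous_comp _ _ _ (f : Cstar R -> C^o) (@complex.Re R : C^o -> R)).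
    exact: continuous_laurent.
  exact: continuous_Re.
by apply: open_comp => [z _|]; [exact: cf|exact: interval_open].
Qed.

Lemma cell_itvP n (t : R) j : cell n t = j <->
  t \in `](j%:~R / 6 ^+ n), ((j%:~R + 1) / 6 ^+ n)].
Proof.
rewrite cellP in_itv /= ltr_pdivrMr ?exprn_gt0// ler_pdivlMr ?exprn_gt0//.
by rewrite mulrC.
Qed.

Lemma measurable_cell n j :
  measurable ([set t : R | cell n t = j] : set (measurableTypeR R)).
Proof.
rewrite [X in measurable X](_ : _ =
  [set` `](j%:~R / 6 ^+ n), ((j%:~R + 1) / 6 ^+ n) : R]]).
  exact: measurable_itv.
by apply/seteqP; split => t /=; rewrite cell_itvP.
Qed.

Lemma measurable_cell_eq n j :
  measurable_fun setT (fun t : measurableTypeR R => (cell n t == j)%:R : R).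
Proof.
have -> : (fun t => (cell n t == j)%:R) = \1_[set t | cell n t = j] :> (R -> R).
  apply/funext => t; rewrite indicE; congr (nat_of_bool _)%:R.
  by apply/eqP/idP => [|/set_mem//] tj; exact/mem_set.
by apply: measurable_indic; exact: measurable_cell.
Qed.

Lemma open_curve_preimage (U : set (Cstar R)) t : open U -> U (curve t) ->
  exists n, forall t', cell n t' = cell n t -> U (curve t').
Proof.
move=> [V oV VU] Ut; have {Ut}Vt : V (Cval (curve t)) by move: Ut; rewrite -VU.
have [e e0 eV] := nbhs_RballP (open_nbhs_nbhs (conj oV Vt)).
have [_ /(_ (e / 2))] := @tame_Cval R `|cell 0 t|%N.
rewrite divr_gt0// => /(_ isT)[n nP]; exists n => t' tt'.
rewrite -VU; apply: eV; apply: le_lt_trans (nP t t' _ (esym tt')) _ => //.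
by rewrite ltcR ltr_pdivrMr// ltr_pMr// ltr1n.
Qed.

(* The preimage of an open set contains a cell around each of its points, so it
   is a countable union of cells. *)
Lemma measurable_curve :
  measurable_fun setT (curve : measurableTypeR R -> Cstar_borel R).
Proof.
apply: (@measurability _ _ (measurableTypeR R) (Cstar_borel R) setT _ (@open (Cstar R))) => //.
move=> _ [U oU <-]; rewrite setTI.
pose F (k : nat * int) : set (measurableTypeR R) :=
  if `[< forall t, cell k.1 t = k.2 -> U (curve t) >]
  then [set t : R | cell k.1 t = k.2] else set0.
rewrite [X in measurable X](_ : _ = \bigcup_k F k).
  apply: countable_bigcupT_measurable; first exact: countableP.
  move=> [n j]; rewrite /F; case: ifP => _; last exact: measurable0.
  exact: measurable_cell.
apply/seteqP; split=> [t /= Ut|t [[n j] _]].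
  have [n nP] := open_curve_preimage oU Ut.
  by exists (n, cell n t) => //; rewrite /F ifT//; apply/asboolP.
by rewrite /F; case: ifPn => //= /asboolP H /H.
Qed.

End borel.

(** * From a positive functional to a measure *)

Section stieltjes.
Import numFieldNormedType.Exports.
Context {R : realType}.

(** A Stieltjes measure needs a right continuous function, so [m] is replaced by its right limit
    [F]; the two agree at points after which [m] is locally constant. *)
Lemma stieltjes_of_monotone (m : R -> R) : nondecreasing m ->
  exists nu : {measure set (measurableTypeR R) -> \bar R}, forall a b, a <= b ->
    (exists2 d, 0 < d & forall s, a < s < a + d -> m s = m a) ->
    (exists2 d, 0 < d & forall s, b < s < b + d -> m s = m b) ->
    nu `]a, b]%classic = (m b - m a)%:E.
Proof.
move=> m_nd; pose V t := [set m s | s in [set s | t < s]].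
pose F t := inf (V t).
have V0 t : V t !=set0 by exists (m (t + 1)), (t + 1) => //=; rewrite ltrDl.
have Vge t l : V t l -> m t <= l by move=> [s /= ts <-]; apply/m_nd/ltW.
have Fle t s : t < s -> F t <= m s.
  by move=> ts; apply: inf_le_lbound (@Vge t) _; exists s.
have F_nd : nondecreasing F.
  move=> s t st; apply: lb_le_inf => // _ [r /= tr <-].
  by apply: Fle; exact: le_lt_trans tr.
have F_rc : right_continuous F.
  move=> t; apply/cvgrPdist_le => e e0.
  have [_ [s /= ts <-] se] := inf_adherent e0 (conj (V0 t) (ex_intro _ _ (@Vge t))).
  near=> r; have tr : t <= r by near: r; exact: nbhs_right_ge.
  have rs : r < s by near: r; exact: nbhs_right_lt.
  rewrite ler0_norm ?subr_le0 ?F_nd// opprB lerBlDl.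
  exact: le_trans (Fle _ _ rs) (ltW se).
pose Fc : cumulative R R :=
  Cumulative.Pack (Cumulative.Class (isCumulative.Build R _ R F F_nd F_rc)).
have FE a : (exists2 d, 0 < d & forall s, a < s < a + d -> m s = m a) -> F a = m a.
  move=> [d d0 dm]; apply/le_anti/andP; split; last exact: lb_le_inf (V0 a) (@Vge a).
  rewrite -(dm (a + d / 2)); first by apply: Fle; rewrite ltrDl divr_gt0.
  by rewrite ltrDl divr_gt0//= ltrD2l ltr_pdivrMr// ltr_pMr// ltr1n.
exists (lebesgue_stieltjes_measure Fc) => a b ab ha hb.
have -> : (m b - m a)%:E = wlength Fc `]a, b]%classic.
  by rewrite wlength_itv_bnd// /= !FE.
by apply: measurable_mu_extE; exact: is_ocitv.
Unshelve. all: end_near.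
Qed.

End stieltjes.

(** * Comparison of the functional with a Stieltjes measure on cells *)

Section cell_measure.
Context {R : realType}.
Variables (pos : Cstar R -> R) (L : bfun (Cstar R) R -> R).
Hypothesis pos_cell : forall z n,
  (cell n (pos z))%:~R + 5^-1 <= 6 ^+ n * pos z <= (cell n (pos z))%:~R + 4 * 5^-1.
Hypothesis L_lin : forall t (u v : bfun (Cstar R) R), L (t *: u + v) = t * L u + L v.
Hypothesis L_mono : forall u v : bfun (Cstar R) R, (forall z, u z <= v z) -> L u <= L v.

Lemma half_line_subproof a :
  (fun z => (pos z <= a)%R%:R : R) \in @bounded_function (Cstar R) R.
Proof.
apply/asboolP; exists 1 => z; case: (pos z <= a); rewrite ?normr1// normr0//.
Qed.

Definition half_line a : bfun (Cstar R) R := Bfun (half_line_subproof a).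

Lemma functional0 : L 0 = 0.
Proof. by have := L_lin (-1) 0 0; rewrite scaleN1r addNr mulN1r addNr. Qed.

Lemma functional_sum (I : Type) (s : seq I) (v : I -> R) (u : I -> bfun (Cstar R) R) :
  L (\sum_(i <- s) v i *: u i) = \sum_(i <- s) v i * L (u i).
Proof.
elim: s => [|i s IHs]; first by rewrite !big_nil functional0.
by rewrite !big_cons L_lin IHs.
Qed.

Lemma bfun_sum (I : Type) (s : seq I) (v : I -> R) (u : I -> bfun (Cstar R) R) z :
  (\sum_(i <- s) v i *: u i : bfun (Cstar R) R) z = \sum_(i <- s) v i * u i z.
Proof.
elim: s => [|i s IHs]; first by rewrite !big_nil.
by rewrite !big_cons -IHs.
Qed.

Lemma functional_ext (u v : bfun (Cstar R) R) : (forall z, u z = v z) -> L u = L v.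
Proof. by move=> uv; apply/le_anti; rewrite !L_mono// => z; rewrite uv. Qed.

(** No value of [pos] falls just after an end point: if [6^n pos z < j + 1/5], its cell index [k]
    satisfies [k < j], whence [6^n pos z <= k + 4/5 <= j]. *)
Lemma half_line_gap n (j : int) : exists2 d, 0 < d &
  forall s, j%:~R / 6 ^+ n < s < j%:~R / 6 ^+ n + d ->
    L (half_line s) = L (half_line (j%:~R / 6 ^+ n)).
Proof.
have p0 : 0 < (6 : R) ^+ n by rewrite exprn_gt0.
exists (5^-1 / 6 ^+ n); first by rewrite divr_gt0.
move=> s; rewrite -mulrDl ltr_pdivrMr// ltr_pdivlMr// => /andP[js sj].
apply: functional_ext => z /=; congr (nat_of_bool _)%:R; rewrite ler_pdivlMr//.
apply/idP/idP => [zs|zj]; last first.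
  by rewrite -(ler_pM2r p0); apply: le_trans zj (ltW js).
have /andP[h1 h2] := pos_cell z n; move: zs; rewrite -(ler_pM2r p0) => zs.
have kj : cell n (pos z) < j.
  rewrite -(ltr_int R); rewrite -(ltrD2r 5^-1); apply: le_lt_trans h1 _.
  by rewrite mulrC; apply: le_lt_trans zs sj.
have kj1 : (cell n (pos z))%:~R + 1 <= j%:~R :> R.
  by rewrite -[1]/(1%:~R) -intrD ler_int lezD1.
by rewrite mulrC; apply: le_trans h2 _; apply: le_trans kj1; rewrite lerD2l; lra.
Qed.

(** [nu] is the Stieltjes measure of [a |-> L (half_line a)]. By [half_line_gap] its value on each
    cell is exact, and linearity extends this to step functions of any level. *)
Lemma cell_measure : exists nu : {measure set (measurableTypeR R) -> \bar R},
  forall n (s : seq int) (v : int -> R) (u : bfun (Cstar R) R),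
    (forall i, 0 <= v i) ->
    (forall z, u z = \sum_(i <- s) v i * (cell n (pos z) == i)%:R) ->
    (\int[nu]_t (\sum_(i <- s) v i * (cell n t == i)%:R)%:E = (L u)%:E)%E.
Proof.
have m_nd : nondecreasing (fun a => L (half_line a)).
  move=> a b ab; apply: L_mono => z /=; rewrite ler_nat.
  by case: (lerP (pos z) a) => [za|//]; rewrite (le_trans za ab).
have [nu nuE] := stieltjes_of_monotone m_nd.
exists nu => n s v u v0 uE.
have p0 : 0 < (6 : R) ^+ n by rewrite exprn_gt0.
(* A difference of half lines: the indicator of the cell [i], pulled back along [pos]. *)
pose d i : bfun (Cstar R) R :=
  (-1) *: half_line (i%:~R / 6 ^+ n) + half_line ((i + 1)%:~R / 6 ^+ n).
have dE i z : d i z = (cell n (pos z) == i)%:R.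
  rewrite -[LHS]/(-1 * (pos z <= i%:~R / 6 ^+ n)%R%:R + (pos z <= (i + 1)%:~R / 6 ^+ n)%R%:R).
  have -> : (cell n (pos z) == i) =
      (i%:~R / 6 ^+ n < pos z) && (pos z <= (i + 1)%:~R / 6 ^+ n).
    rewrite intrD; apply/eqP/idP => [/cell_itvP|h]; first by rewrite in_itv.
    by apply/cell_itvP; rewrite in_itv.
  have le_i : i%:~R / 6 ^+ n <= (i + 1)%:~R / 6 ^+ n :> R.
    by rewrite ler_pM2r ?invr_gt0// ler_int lerDl.
  case: (lerP (pos z)) => [zi|zi] /=; last by rewrite mulr0 add0r.
  by rewrite (le_trans zi le_i) mulN1r addNr.
have nu_cell i : nu [set t | cell n t = i] = (L (d i))%:E.
  rewrite L_lin mulN1r addrC -nuE; last 3 first.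
  - by rewrite ler_pM2r ?invr_gt0// ler_int lerDl.
  - exact: half_line_gap.
  - exact: half_line_gap.
  congr (nu _); apply/seteqP; split => t /=; rewrite cell_itvP ?intrD//.
have -> : L u = \sum_(i <- s) v i * L (d i).
  rewrite -functional_sum; apply: functional_ext => z; rewrite uE bfun_sum.
  by apply: eq_bigr => i _; rewrite dE.
have cellE i : (fun t => (cell n t == i)%:R) = \1_[set t | cell n t = i] :> (R -> R).
  apply/funext => t; rewrite indicE; congr (nat_of_bool _)%:R.
  by apply/eqP/idP => [|/set_mem//] ti; exact/mem_set.
under eq_integral do rewrite -sumEFin.
rewrite ge0_integral_sum//.
- rewrite -sumEFin; apply: eq_bigr => i _.
  under eq_integral do rewrite EFinM.
  rewrite ge0_integralZl_EFin//; last by apply/measurable_EFinP; exact: measurable_cell_eq.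
  rewrite EFinM -nu_cell; congr (_ * _)%E.
  have := integral_indic nu measurableT (measurable_cell n i); rewrite setIT => <-.
  by apply: eq_integral => t _; rewrite -cellE.
- move=> i; apply/measurable_EFinP/measurable_funM; first exact: measurable_cst.
  exact: measurable_cell_eq.
- by move=> i t _; rewrite lee_fin mulr_ge0.
Qed.

End cell_measure.

(** * Representation of a positive functional by a measure *)

Section representation.
Import numFieldNormedType.Exports.
Context {R : realType}.

Lemma cell_bound n (t : R) J : (`|cell 0 t| <= J)%N ->
  - (J.+1 * 6 ^ n)%N%:Z <= cell n t < (J.+1 * 6 ^ n)%N.
Proof.
move=> tJ; elim: n => [|n /andP[h1 h2]]; first by rewrite expn0; lia.
have /andP[h3 h4] := cellS n t; rewrite expnS mulnCA; move: (J.+1 * 6 ^ n)%N h1 h2 => K.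
lia.
Qed.

(** On a large annulus uniform continuity gives an error [e <= e w]; outside it the step function is
    [0] and the decay of [f] relative to [w] gives the bound. *)
Lemma step_approx (f w : Cstar R -> R) :
  (forall J (e : R), 0 < e -> exists n, forall t t', (`|cell 0 t| <= J)%N ->
     cell n t = cell n t' -> `|f (curve t) - f (curve t')| <= e) ->
  (forall z, 1 <= w z) ->
  (forall e : R, 0 < e -> exists J, forall t, (J < `|cell 0 t|)%N ->
     `|f (curve t)| <= e * w (curve t)) ->
  (forall z, 0 <= f z) -> forall e : R, 0 < e ->
  exists n (s : seq int) (v : int -> R), (forall i, 0 <= v i) /\
    forall t, `|f (curve t) - \sum_(i <- s) v i * (cell n t == i)%:R| <= e * w (curve t).
Proof.
move=> f_osc w1 f_decay f0 e e0.
have [J fJ] := f_decay e e0; have [n fn] := f_osc J e e0.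
(* The right end point represents its cell, because it belongs to it. *)
pose rep (i : int) : R := (i + 1)%:~R / 6 ^+ n.
have p0 : 0 < (6 : R) ^+ n by rewrite exprn_gt0.
have repE i : cell n (rep i) = i.
  by apply/cellP; rewrite /rep mulrC divfK ?lt0r_neq0// intrD ltrDl ltr01 lexx.
pose K := (J.+1 * 6 ^ n)%N.
pose s := [seq i%:Z - K%:Z | i <- iota 0 (K.*2)].
have uniq_s : uniq s.
  by rewrite map_inj_uniq ?iota_uniq// => i j /addIr[].
pose v i := if (`|cell 0 (rep i)| <= J)%N then f (curve (rep i)) else 0.
exists n, s, v; split=> [i|t]; first by rewrite /v; case: ifP.
have -> : \sum_(i <- s) v i * (cell n t == i)%:R =
    if cell n t \in s then v (cell n t) else 0.
  case: ifPn => [ts|ts].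
    rewrite (bigD1_seq (cell n t))//= eqxx mulr1 big1 ?addr0// => i.
    by rewrite eq_sym => /negbTE->; rewrite mulr0.
  rewrite big1_seq// => i /andP[_ si]; case: eqP => [ti|_]; last by rewrite mulr0.
  by rewrite ti si in ts.
have cell0E : cell 0 (rep (cell n t)) = cell 0 t.
  by apply: (@cell_nest _ 0 n); rewrite ?repE.
have [tJ|tJ] := leqP `|cell 0 t| J.
  have -> : cell n t \in s.
    have /andP[h1 h2] := cell_bound n tJ; apply/mapP.
    have cK : `|(cell n t + K%:Z)%R|%N%:Z = cell n t + K%:Z.
      by apply: gez0_abs; rewrite -lerBlDr sub0r.
    exists `|(cell n t + K%:Z)%R|%N; last by rewrite cK addrK.
    rewrite mem_iota /= add0n -ltz_nat cK -addnn PoszD.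
    by rewrite ltrD2r.
  rewrite /v cell0E tJ; apply: (@le_trans _ _ e); last by rewrite ler_peMr// ltW.
  by apply: fn; rewrite ?repE.
rewrite (_ : (if _ then _ else _) = 0) ?subr0 ?fJ//.
by case: ifP => // _; rewrite /v cell0E leqNgt tJ.
Qed.

Lemma cvg_inv_bound (x C : R) (u : nat -> R) :
  (forall k, `|x - u k| <= k.+1%:R^-1 * C) -> u @ \oo --> x.
Proof.
move=> xu; apply/cvgrPdist_le => e e0; pose N := Num.bound (`|C| / e).
exists N => //= k Nk; apply: le_trans (xu k) _.
rewrite ler_pdivrMl ?ltr0n//; apply: le_trans (ler_norm C) _.
rewrite mulrC -ler_pdivrMl// mulrC.
apply: le_trans (ltW (archi_boundP _)) _; first by rewrite divr_ge0// ltW.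
by rewrite ler_nat ltnW.
Qed.

Lemma le_inv_bound (a b C : R) : (forall k, a <= b + k.+1%:R^-1 * C) -> a <= b.
Proof.
move=> abC; apply/ler_addgt0Pr => e e0; pose N := Num.bound (`|C| / e).
apply: le_trans (abC N) _; rewrite lerD2l ler_pdivrMl ?ltr0n//.
apply: le_trans (ler_norm C) _; rewrite mulrC -ler_pdivrMl// mulrC.
apply: le_trans (ltW (archi_boundP _)) _; first by rewrite divr_ge0// ltW.
by rewrite ler_nat.
Qed.

(* [G f l] reads: [f] belongs to the domain of the functional, with value [l].
   Step functions give [l <= \int f] only up to [\int w], which has to be bounded
   first: this is the inequality [\int f <= l] applied to [w], by Fatou's lemma. *)
Theorem representation (G : (Cstar R -> R) -> R -> Prop) :
  (forall t f l g m, G f l -> G g m -> G (fun z => t * f z + g z) (t * l + m)) ->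
  (forall f l, G f l -> (forall z, 0 <= f z) -> 0 <= l) ->
  (forall f l, G f l -> [/\ measurable_fun setT (f : Cstar_borel R -> R),
    forall J (e : R), 0 < e -> exists n, forall t t', (`|cell 0 t| <= J)%N ->
      cell n t = cell n t' -> `|f (curve t) - f (curve t')| <= e &
    exists w m, [/\ G w m, forall z, 1 <= w z,
      exists C, forall z, `|f z| <= C * w z &
      forall e : R, 0 < e -> exists J, forall t, (J < `|cell 0 t|)%N ->
        `|f (curve t)| <= e * w (curve t)]]) ->
  (exists f l, G f l) ->
  exists mu : {measure set (Cstar_borel R) -> \bar R}, forall f l, G f l ->
    mu.-integrable setT (EFin \o f) /\ \int[mu]_z f z = l.
Proof.
move=> Glin Gpos Gtame [f1 [l1 Gf1]].
have [_ _ [w1 [m1 [Gw1 w1_ge1 _ _]]]] := Gtame _ _ Gf1.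
have [L [Llin Lext]] := positive_extension Glin Gpos
  (ex_intro _ w1 (ex_intro _ m1 (conj Gw1 w1_ge1))).
have G0 : G (fun=> 0) 0.
  have := Glin (-1) _ _ _ _ Gw1 Gw1; rewrite mulN1r addNr.
  by congr G; apply/funext => z; rewrite mulN1r addNr.
have L0 : L 0 = 0 by have := Llin (-1) 0 0; rewrite scaleN1r addNr mulN1r addNr.
have LN u : L (- u) = - L u.
  by have := Llin (-1) u 0; rewrite scaleN1r addr0 mulN1r L0 addr0.
have L_mono (u v : bfun (Cstar R) R) : (forall z, u z <= v z) -> L u <= L v.
  move=> uv; rewrite -subr_le0.
  have -> : L u - L v = L (u - v) by rewrite -LN -[u]scale1r Llin mul1r scale1r.
  by apply: Lext G0 _ => z; rewrite -[leLHS]/(u z - v z) subr_le0.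
have [pos posP] := @curve_section R.
have [nu nuE] := @cell_measure R pos L (fun z => (posP z).2) Llin L_mono.
(* The step function is compared with [f] along the curve and, through [pos], on the plane: there
   [|f - s (pos z)| <= e w] puts [L u = r] between [l - e m] and [l + e m]. *)
have approx f l w m e : G f l -> (forall z, 0 <= f z) -> 0 < e ->
    G w m -> (forall z, 1 <= w z) ->
    (forall e : R, 0 < e -> exists J, forall t, (J < `|cell 0 t|)%N ->
        `|f (curve t)| <= e * w (curve t)) ->
    exists (s : R -> R) (r : R), [/\ measurable_fun setT (s : measurableTypeR R -> R),
      forall t, 0 <= s t, forall t, `|f (curve t) - s t| <= e * w (curve t),
      (\int[nu]_t (s t)%:E = r%:E)%E & `|r - l| <= e * m].
  move=> Gf f0 e0 Gw w_ge1 fw; have [_ f_osc _] := Gtame _ _ Gf.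
  have [n [I [v [v0 sP]]]] := step_approx f_osc w_ge1 fw f0 e0.
  pose s (t : R) : R := \sum_(i <- I) v i * (cell n t == i)%:R.
  have s0 t : 0 <= s t by apply: sumr_ge0 => i _; rewrite mulr_ge0.
  have u_bounded : (fun z => s (pos z)) \in @bounded_function (Cstar R) R.
    apply/asboolP; exists (\sum_(i <- I) v i) => z; rewrite ger0_norm//.
    by apply: ler_sum => i _; case: eqP => _; rewrite ?mulr1// mulr0.
  pose u := Bfun u_bounded.
  exists s, (L u); split=> //.
  - apply: measurable_sum => i; apply: measurable_funM; first exact: measurable_cst.
    exact: measurable_cell_eq.
  - exact: nuE.
  - have sposP z : `|f z - s (pos z)| <= e * w z.
      by have := sP (pos z); rewrite (posP z).1.
    have Gew := Glin e _ _ _ _ Gw G0.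
    have h1 : L u <= e * m + l.
      apply: (Lext _ _ _ (Glin e _ _ _ _ Gw Gf)) => z /=.
      by have := sposP z; rewrite ler_norml => /andP[]; lra.
    have h2 : L (- u) <= -1 * l + (e * m + 0).
      apply: (Lext _ _ _ (Glin (-1) _ _ _ _ Gf Gew)) => z.
      rewrite -[leLHS]/(- s (pos z)).
      by have := sposP z; rewrite ler_norml => /andP[]; lra.
    by move: h2; rewrite LN ler_norml => h2; apply/andP; split; lra.
have m_curve f l : G f l ->
    measurable_fun setT (fun t : measurableTypeR R => (f (curve t))%:E).
  move=> /Gtame[mf _ _]; apply/measurable_EFinP.
  exact: (measurableT_comp mf measurable_curve).
have int_le f l : G f l -> (forall z, 0 <= f z) ->
    (\int[nu]_t (f (curve t))%:E <= l%:E)%E.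
  move=> Gf f0; have [_ _ [w [m [Gw w_ge1 _ fw]]]] := Gtame _ _ Gf.
  have /choice[s /choice[r sP]] := fun k : nat =>
    @approx f l w m k.+1%:R^-1 Gf f0 (ltac:(by rewrite invr_gt0 ltr0n)) Gw w_ge1 fw.
  have s_lim t : limn_einf (fun k => (s k t)%:E) = (f (curve t))%:E.
    apply: (cvg_limn_einf_sup _).1; apply: cvg_EFin; first exact: nearW.
    apply: (@cvg_inv_bound _ (w (curve t))) => k.
    by have [_ _ ->] := sP k.
  have r_lim : limn_einf (fun k => \int[nu]_t (s k t)%:E)%E = l%:E.
    apply: (cvg_limn_einf_sup _).1.
    rewrite (_ : (fun k => _) = EFin \o r); last first.
      by apply/funext => k; have [_ _ _ ->] := sP k.
    apply: cvg_EFin; first exact: nearW.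
    apply: (@cvg_inv_bound _ m) => k /=.
    by have [_ _ _ _] := sP k; rewrite distrC.
  under eq_integral do rewrite -s_lim.
  rewrite -r_lim; apply: fatou => //.
    by move=> k; apply/measurable_EFinP; have [] := sP k.
  by move=> k t _; rewrite lee_fin; have [_ ->] := sP k.
have int_eq f l : G f l -> (forall z, 0 <= f z) ->
    (\int[nu]_t (f (curve t))%:E = l%:E)%E.
  move=> Gf f0; have [_ _ [w [m [Gw w_ge1 _ fw]]]] := Gtame _ _ Gf.
  have w0 z : 0 <= w z := le_trans ler01 (w_ge1 z).
  have int0 g : (forall z, 0 <= g z) -> (0 <= \int[nu]_t (g (curve t))%:E)%E.
    by move=> g0; apply: integral_ge0 => t _; rewrite lee_fin.
  have fin_int g k : G g k -> (forall z, 0 <= g z) ->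
      exists2 x : R, (\int[nu]_t (g (curve t))%:E)%E = x%:E & x <= k.
    move=> Gg g0; have := int_le _ _ Gg g0; have := int0 _ g0.
    by case: (integral _ _ _) => [x _| |] //; exists x.
  have [x fx xl] := fin_int _ _ Gf f0; have [y wy ym] := fin_int _ _ Gw w0.
  rewrite fx; congr EFin; apply/le_anti; rewrite xl /=.
  (* With [e = k.+1^-1], integrating [s <= f + e w] gives [r <= x + e y], and [l <= r + e m]; here
     [y], the integral of [w], is finite by [int_le]. *)
  apply: (@le_inv_bound _ _ (m + y)) => k.
  have e0 : 0 < k.+1%:R^-1 :> R by rewrite invr_gt0 ltr0n.
  have [s [r [ms s0 fs sr rl]]] := approx _ _ _ _ _ Gf f0 e0 Gw w_ge1 fw.
  have : (r%:E <= x%:E + (k.+1%:R^-1 * y)%:E)%E.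
    rewrite -sr -fx EFinM -wy -ge0_integralZl_EFin//; last 2 first.
    - by move=> t _; rewrite lee_fin.
    - exact: m_curve Gw.
    rewrite -ge0_integralD//; last 4 first.
    - by move=> t _; rewrite lee_fin.
    - exact: m_curve Gf.
    - by move=> t _; rewrite -EFinM lee_fin mulr_ge0// ltW.
    - by apply: measurable_funeM; exact: m_curve Gw.
    apply: ge0_le_integral => //.
    - by move=> t _; rewrite lee_fin.
    - by apply/measurable_EFinP; exact: ms.
    - apply: emeasurable_funD; first exact: m_curve Gf.
      by apply: measurable_funeM; exact: m_curve Gw.
    move=> t _; rewrite -EFinM -EFinD lee_fin.
    by have := fs t; rewrite ler_norml; move: (_ * w _) => a /andP[]; lra.
  rewrite -EFinD lee_fin; move: rl; rewrite ler_norml mulrDr => /andP[].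
  by move: (k.+1%:R^-1 * m) (k.+1%:R^-1 * y) => a b; lra.
have mcurve := @measurable_curve R.
pose mu : {measure set (Cstar_borel R) -> \bar R} :=
  measure_function_pushforward__canonical__measure_function_Measure nu mcurve.
have mu_eq f l : G f l -> (forall z, 0 <= f z) -> (\int[mu]_z (f z)%:E = l%:E)%E.
  move=> Gf f0; rewrite -(int_eq _ _ Gf f0); have [mf _ _] := Gtame _ _ Gf.
  rewrite (@ge0_integral_pushforward _ _ _ _ _ _ mcurve)//; first exact/measurable_EFinP.
  by move=> z _; rewrite lee_fin.
have mu_int f l : G f l -> (forall z, 0 <= f z) -> mu.-integrable setT (EFin \o f).
  move=> Gf f0; have [mf _ _] := Gtame _ _ Gf; apply/integrableP; split.
    exact/measurable_EFinP.
  under eq_integral do rewrite /= ger0_norm//.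
  by rewrite (mu_eq _ _ Gf f0) ltry.
exists mu => f l Gf; have [_ _ [w [m [Gw w_ge1 [C fC] _]]]] := Gtame _ _ Gf.
have w0 z : 0 <= w z := le_trans ler01 (w_ge1 z).
(* [f] is [h - C w] with [h] and [w] nonnegative members of the domain. *)
pose h z := C * w z + f z; have Gh : G h (C * m + l) := Glin _ _ _ _ _ Gw Gf.
have h0 z : 0 <= h z.
  by have := fC z; rewrite ler_norml /h => /andP[]; lra.
have fE : f = fun z => h z - C * w z by apply/funext => z; rewrite /h addrAC subrr add0r.
have w_int := mu_int _ _ Gw w0; have h_int := mu_int _ _ Gh h0.
have Cw_int : mu.-integrable setT (EFin \o (fun z => C * w z)).
  exact: (integrableZl measurableT C w_int).
split; first by rewrite fE; exact: (integrableB measurableT h_int Cw_int).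
rewrite fE RintegralB// RintegralZl// /Rintegral (mu_eq _ _ Gh h0) (mu_eq _ _ Gw w0) /=.
by rewrite addrAC subrr add0r.
Qed.

End representation.

(** * The moment problem *)

Section moment_functional.
Context {R : realType}.
Local Notation C := R[i].

Lemma ReD (x y : C) : complex.Re (x + y) = complex.Re x + complex.Re y.
Proof. by case: x y => ? ? []. Qed.

Lemma ReZ (t : R) (x : C) : complex.Re (t%:C%C * x) = t * complex.Re x.
Proof. by case: x => a b /=; rewrite mul0r subr0. Qed.

Lemma Re_conj_half (x : C) : 2^-1 * (x + x^*) = (complex.Re x)%:C%C.
Proof. by rewrite ReJ_add mulrC. Qed.

Lemma laurent_sum_laurent_fun (T : set (int * int)) (p : int * int -> C) :
  finite_system T p -> laurent_fun (laurent_sum T p).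
Proof.
move=> fp; have [s [_ _ sE]] := finite_system_seq fp.
have := laurent_fun_bigsum (R := R) s p id; congr laurent_fun.
by apply/funext => z; rewrite /laurent_sum sE.
Qed.

Lemma normr_exprz (x : C) (n : int) : `|x ^ n| = `|x| ^ n.
Proof.
case: n => n; first by rewrite -!exprnP normrX.
by rewrite NegzE -!exprnN normfV normrX.
Qed.

Lemma norm_monom m n (z : Cstar R) : `|monom (m, n) z| = `|Cval z| ^ (m + n).
Proof.
by rewrite monomE normrM !normr_exprz norm_conjC -expfzDr// normr_eq0 Cval_neq0.
Qed.

Lemma exprz_le_both (x : R) (e : int) (N : nat) : 0 < x -> (`|e| <= N)%N ->
  x ^ e <= x ^+ N + x ^- N.
Proof.
move=> x0 eN; have p k : 0 <= x ^+ k by rewrite exprn_ge0// ltW.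
have q k : 0 <= x ^- k by rewrite invr_ge0.
have [x1|x1] := lerP 1 x.
  apply: (@le_trans _ _ (x ^+ N)); last by rewrite lerDl.
  by rewrite exprnP; apply: ler_weXz2l => //; lia.
apply: (@le_trans _ _ (x ^- N)); last by rewrite lerDr.
have -> : x ^ e = x^-1 ^ (- e) by rewrite exprz_inv opprK.
rewrite -exprVn exprnP; apply: ler_weXz2l; last lia.
by rewrite invr_ge1 ?unitfE ?lt0r_neq0// ltW.
Qed.

Variables (T : set (int * int)) (c : int * int -> C).
Hypothesis T_sym : forall m n, T (m, n) -> T (n, m).
Hypothesis T_diag : forall n, T (n, n).
Hypothesis c_pos : forall p : int * int -> C, finite_system T p ->
  (forall z : Cstar R, 0 <= laurent_sum T p z) -> 0 <= \sum_(k \in T) p k * c k.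

Lemma moment_diag_ge0 n : 0 <= c (n, n).
Proof.
have := c_pos (finite_system_single T (n, n) 1); rewrite fsum_single// mul1r.
apply=> z; rewrite /laurent_sum fsum_single// mul1r.
exact/ltW/monom_diag_gt0.
Qed.

(** Positivity on the squares of [sos_absorb] makes [a c_mn + a^* c_nm] real for all [a]; the values
    [a = 1] and [a = 'i] give the two equations. *)
Lemma moment_hermitian m n : T (m, n) -> c (n, m) = (c (m, n))^*.
Proof.
move=> Tmn; have Tnm := T_sym Tmn.
have H (a : C) : (a * c (m, n) + a^* * c (n, m)) \is Num.real.
  have fs k (x : C) : finite_system T (single k x) by exact: finite_system_single.
  have f2 := finite_systemD (fs (m, m) `|a|) (fs (n, n) `|a|).
  have f3 := finite_systemD (fs (n, m) a^*) f2.
  pose p k := single (m, n) a k + (single (n, m) a^* k +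
    (single (m, m) `|a| k + single (n, n) `|a| k)).
  have fp : finite_system T p := finite_systemD (fs (m, n) a) f3.
  have pE (g : int * int -> C) : \sum_(k \in T) p k * g k =
      a * g (m, n) + (a^* * g (n, m) + (`|a| * g (m, m) + `|a| * g (n, n))).
    rewrite (fsumD g (fs (m, n) a) f3) (fsumD g (fs (n, m) a^*) f2).
    rewrite (fsumD g (fs (m, m) `|a|) (fs (n, n) `|a|)).
    by rewrite !fsum_single.
  have := c_pos fp; rewrite pE addrA => /(_ _)/ger0_real h.
  rewrite -(rpredDr _ (_ : `|a| * c (m, m) + `|a| * c (n, n) \is Num.real)).
    apply: h => z; rewrite /laurent_sum pE.
    have := sos_ge0 z (sos_absorb (R := R) a m n).
    by rewrite rmorphM/= monom_conj mulrDr !addrA.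
  by rewrite ger0_real// addr_ge0// mulr_ge0// moment_diag_ge0.
have := H 1; have := H 'i; rewrite conjCi conjC1 !mul1r.
move: (c (m, n)) (c (n, m)) => [x y] [x' y'].
rewrite -complexiE; simpc; rewrite !complex_real => /eqP h1 /eqP h2.
by rewrite /Num.conj /=; congr Complex; lra.
Qed.

(** A relation, since systems [p] with the same real part need not be equal; that [f] determines [l]
    follows from [moment_graph_ge0] applied to differences. *)
Definition moment_graph (f : Cstar R -> R) (l : R) := exists p,
  [/\ finite_system T p, forall z, f z = complex.Re (laurent_sum T p z) &
      l = complex.Re (\sum_(k \in T) p k * c k)].

Lemma moment_graph_lin t f l g m : moment_graph f l -> moment_graph g m ->
  moment_graph (fun z => t * f z + g z) (t * l + m).
Proof.
move=> [p [fp fE ->]] [q [fq gE ->]]; exists (fun k => t%:C%C * p k + q k).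
have fZ : finite_system T (fun k => t%:C%C * p k) by exact: finite_systemZ.
split=> [|z|]; first exact: finite_systemD.
  by rewrite /laurent_sum (fsumD (fun k => monom k z) fZ fq) fsumZ ReD ReZ fE gE.
by rewrite (fsumD c fZ fq) fsumZ ReD ReZ.
Qed.

(** The system is made hermitian: half of [p k] stays at [k] and half of its conjugate goes to the
    swapped index. Its Laurent sum is then [f] itself, and its value is [l] because [c] is
    hermitian. *)
Lemma moment_graph_ge0 f l : moment_graph f l -> (forall z, 0 <= f z) -> 0 <= l.
Proof.
move=> [p [fp fE ->]] f0; have [s [_ sT sE]] := finite_system_seq fp.
pose q k i := single k (2^-1 * p k) i + single (k.2, k.1) (2^-1 * (p k)^*) i.
have sT' k : k \in s -> T (k.2, k.1) by case: k => m n /sT; exact: T_sym.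
have fq k : finite_system T (q k).
  by apply: finite_systemD; exact: finite_system_single.
have qE (g : int * int -> C) :
    (forall k, k \in s -> g (k.2, k.1) = (g k)^*) ->
    \sum_(i \in T) (\sum_(k <- s) q k i) * g i =
    (complex.Re (\sum_(k \in T) p k * g k))%:C%C.
  move=> gJ; rewrite fsum_fsum// sE -Re_conj_half rmorph_sum -big_split mulr_sumr.
  apply: eq_big_seq => k ks; have Tk := sT _ ks; have Tk' := sT' _ ks.
  rewrite /q fsumD; [|exact: finite_system_single|exact: finite_system_single].
  by rewrite !fsum_single// gJ// rmorphM/= -!mulrA mulrDr.
have := @c_pos (fun i => \sum_(k <- s) q k i).
rewrite qE => [|[m n] ks]; last by apply: moment_hermitian; exact: sT.
rewrite ler0c; apply; first exact: finite_system_fsum.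
move=> z; rewrite /laurent_sum qE => [|[m n] _]; last by rewrite monom_conj.
by rewrite ler0c -fE.
Qed.

Lemma moment_graph_weight (N : nat) : exists w m, moment_graph w m /\
  forall z, w z = complex.Re `|Cval z| ^+ N.*2 + complex.Re `|Cval z| ^- N.*2.
Proof.
pose p k := single (N%:Z, N%:Z) (1 : C) k + single (- N%:Z, - N%:Z) 1 k.
have fp : finite_system T p by apply: finite_systemD; exact: finite_system_single.
exists (fun z => complex.Re (laurent_sum T p z)).
exists (complex.Re (\sum_(k \in T) p k * c k)).
split=> [|z]; first by exists p.
rewrite /laurent_sum fsumD; [|exact: finite_system_single|exact: finite_system_single].
rewrite !fsum_single// !mul1r !monom_diag ReD.
have N2 : N%:Z *+ 2 = N.*2%:Z by rewrite mulr2n -PoszD addnn.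
rewrite mulNrn N2 -exprnP -exprnN.
have -> : `|Cval z| = (complex.Re `|Cval z|)%:C%C by rewrite RRe_real ?normr_real.
by rewrite -!rmorphXn -fmorphV /=.
Qed.

(** The weight [|z|^(2N) + |z|^(-2N)] outgrows [f] both at [0] and at infinity. *)
Lemma moment_graph_tame f l : moment_graph f l ->
  [/\ measurable_fun setT (f : Cstar_borel R -> R),
    forall J (e : R), 0 < e -> exists n, forall t t', (`|cell 0 t| <= J)%N ->
      cell n t = cell n t' -> `|f (curve t) - f (curve t')| <= e &
    exists w m, [/\ moment_graph w m, forall z, 1 <= w z,
      exists C, forall z, `|f z| <= C * w z &
      forall e : R, 0 < e -> exists J, forall t, (J < `|cell 0 t|)%N ->
        `|f (curve t)| <= e * w (curve t)]].
Proof.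
move=> [p [fp fE _]]; have pL := laurent_sum_laurent_fun fp.
have {}fE : f = fun z => complex.Re (laurent_sum T p z) by apply/funext.
split.
- by rewrite fE; exact: measurable_Re_laurent.
- move=> J e e0; have [_ /(_ e e0)[n nP]] := tame_laurent pL J.
  exists n => t t' tJ tt'; have := nP t t' tJ tt'; rewrite fE -lecR; apply: le_trans.
  have ReB (u v : C) : complex.Re u - complex.Re v = complex.Re (u - v).
    by case: u v => ? ? [].
  by rewrite ReB; exact: normc_ge_Re.
have [s [_ sT sE]] := finite_system_seq fp.
(* [N] exceeds the degree of each term, which leaves room for a shift [i] of the exponent by one. *)
pose N := (\sum_(k <- s) (`|k.1| + `|k.2|)).+1%N.
have sN k (i : int) : k \in s -> (`|i| <= 1)%N -> (`|(k.1 + k.2 + i)%R| <= N.*2)%N.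
  move=> ks i1; have kN : (`|k.1| + `|k.2| < N)%N.
    by rewrite /N ltnS (big_rem _ ks) /= leq_addr.
  by case: k {ks} kN => k1 k2 /= kN; lia.
have [w [m [Gw wE]]] := moment_graph_weight N.
pose r (z : Cstar R) : R := complex.Re `|Cval z|.
have rE z : `|Cval z| = (r z)%:C%C by rewrite RRe_real ?normr_real.
have r0 z : 0 < r z by rewrite -ltcR -rE normr_gt0 Cval_neq0.
pose A := \sum_(k <- s) complex.Re `|p k|.
have A0 : 0 <= A by apply: sumr_ge0 => k _; rewrite -ler0c RRe_real ?normr_real.
(* [i = 0] bounds [f], [i = 1] gives decay at infinity and [i = -1] decay at [0]. *)
have fA z (i : int) : (`|i| <= 1)%N -> `|f z| * r z ^ i <= A * w z.
  move=> i1; have ri0 : 0 <= r z ^ i by rewrite exprz_ge0// ltW.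
  rewrite -lecR !rmorphM; apply: (@le_trans _ _ (`|laurent_sum T p z| * (r z ^ i)%:C%C)).
    by rewrite ler_wpM2r ?ler0c// fE; exact: normc_ge_Re.
  rewrite /laurent_sum sE rmorph_sum mulr_suml.
  apply: le_trans (ler_wpM2r _ (ler_norm_sum _ _ _)) _; first by rewrite ler0c.
  rewrite mulr_suml big_seq [leRHS]big_seq; apply: ler_sum => -[k1 k2] ks.
  rewrite -[X in _ <= X * _]/((complex.Re `|p (k1, k2)|)%:C%C).
  rewrite (RRe_real (normr_real _)) normrM -mulrA ler_wpM2l// norm_monom rE.
  rewrite -fmorphXz -rmorphM lecR -expfzDr ?lt0r_neq0// wE.
  by apply: exprz_le_both => //; exact: (sN (k1, k2)).
exists w, m; split=> //.
- move=> z; rewrite wE -/(r z).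
  have [r1|r1] := lerP 1 (r z).
    by rewrite ler_wpDr ?invr_ge0 ?exprn_ge0 ?exprn_ege1// ltW.
  rewrite ler_wpDl ?exprn_ge0 ?(ltW (r0 z))// -exprVn exprn_ege1//.
  by rewrite invr_ge1 ?unitfE ?lt0r_neq0// ltW.
- by exists A => z; have := fA z 0 isT; rewrite expr0z mulr1.
move=> e e0; have [n nA] := ex_lt_pow2 (4 * A / e).
have {}nA : 4 * A <= e * 2 ^+ n by rewrite [leRHS]mulrC -ler_pdivrMr// ltW.
(* Four sectors make up a dyadic ring, so such an index forces [|z| >= 2^n] or [|z| <= 4 * 2^-n];
   the [4] in the choice of [n] pays for the latter. *)
exists (n.+1 * 4)%N => t Jt.
have [rl ru] : 2 ^ (cell 0 t %/ 4)%Z <= r (curve t) /\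
    r (curve t) <= 4 * 2 ^ (cell 0 t %/ 4)%Z.
  by have /andP[] := norm_curve t; rewrite rE !lecR.
have w0 : 0 <= w (curve t).
  have h := ltW (r0 (curve t)).
  by rewrite wE -/(r (curve t)) addr_ge0 ?invr_ge0 ?exprn_ge0.
have r1 := r0 (curve t); have pn : 0 < (2 : R) ^+ n by rewrite exprn_gt0.
have [j0|j0] := lerP 0 (cell 0 t).
  have nr : 2 ^+ n <= r (curve t).
    by apply: le_trans rl; rewrite exprnP; apply: ler_weXz2l; [rewrite ler1n|lia].
  rewrite -(ler_pM2r r1); have := fA (curve t) 1 isT; rewrite expr1z => /le_trans; apply.
  rewrite mulrAC ler_wpM2r//; have : e * 2 ^+ n <= e * r (curve t) by rewrite ler_pM2l.
  lra.
have nr : r (curve t) * 2 ^+ n <= 4.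
  rewrite -ler_pdivlMr//; apply: le_trans ru _; rewrite ler_pM2l//.
  by rewrite exprnN; apply: ler_weXz2l; [rewrite ler1n|lia].
have := fA (curve t) (-1) isT; rewrite exprN1 ler_pdivrMr// => /le_trans; apply.
rewrite mulrAC ler_wpM2r//; apply: (@le_trans _ _ (4^-1 * (e * 2 ^+ n) * r (curve t))).
  by rewrite ler_pM2r//; lra.
have : e * (r (curve t) * 2 ^+ n) <= e * 4 by rewrite ler_pM2l.
by rewrite (_ : 4^-1 * _ * _ = 4^-1 * (e * (r (curve t) * 2 ^+ n))); [lra|ring].
Qed.

End moment_functional.

Theorem theorem40 (R : realType) (T : set (int * int)) (Z : set R[i])
    (T_sym : forall m n, T (m, n) -> T (n, m))
    (T_diag : forall n, T (n, n))
    (Z_neq0 : Z `<=` [set z | z != 0])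
    (Z_det : determining Z)
    (c : int * int -> R[i]) :
  [<-> exists mu : {measure set (Cstar_borel R) -> \bar R},
         forall k, T k ->
           cintegrable mu (monom k) /\ c k = cintegral mu (monom k);
       forall p : int * int -> R[i], finite_system T p ->
         (forall z : Cstar R, 0 <= laurent_sum T p z) ->
         0 <= \sum_(k \in T) p k * c k;
       forall p : int * int -> R[i], finite_system T p ->
         (exists (n : nat) (q : 'I_n -> Cstar R -> R[i]),
            (forall j, laurent_fun (q j)) /\
            (forall z : Cstar R, Z (Cval z) ->
               laurent_sum T p z = \sum_(j < n) `|q j z| ^+ 2)) ->
         0 <= \sum_(k \in T) p k * c k].
Proof.
tfae.
- move=> [mu muP] p fp p0; have [s [_ sT sE]] := finite_system_seq fp.
  have [_ pE] := cintegral_sum p (fun k ks => (muP k (sT k ks)).1).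
  rewrite sE (eq_big_seq (fun k => p k * cintegral mu (monom k))).
    by rewrite -pE; apply: cintegral_ge0 => z; rewrite -sE; exact: p0.
  by move=> k /sT/muP[_ <-].
- move=> cpos p fp [n [q [qL pq]]]; apply: cpos => // z.
  rewrite (determining_eq Z_det Z_neq0 _ _ pq).
  + by apply: sumr_ge0 => j _; rewrite exprn_ge0.
  + exact/laurent_fun_polynomial/laurent_sum_laurent_fun.
  + apply: polynomial_up_to_power_sum => j.
    under [X in polynomial_up_to_power X]eq_fun do rewrite normCK.
    apply: polynomial_up_to_powerM; apply: laurent_fun_polynomial => //.
    exact: laurent_fun_conj.
move=> csos.
(* An identity on the whole punctured plane holds in particular on [Z], so (iii) applies to the sums
   of squares of [sos_cone_nonneg]. *)
have cpos p : finite_system T p -> (forall z : Cstar R, 0 <= laurent_sum T p z) ->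
    0 <= \sum_(k \in T) p k * c k.
  apply: sos_cone_nonneg => // {}p fp [n [q [qL pq]]].
  by apply: csos => //; exists n, q.
have [|mu muP] := representation (@moment_graph_lin R T c)
  (moment_graph_ge0 T_sym T_diag cpos) (moment_graph_tame T_diag).
  by have [w [m [Gw _]]] := moment_graph_weight c T_diag 0; exists w, m.
exists mu => k Tk.
(* The values [a = 1] and [a = - 'i] give the real and the imaginary part of the moment. *)
have Ga (a : R[i]) : moment_graph T c (fun z => complex.Re (a * monom k z))
    (complex.Re (a * c k)).
  exists (single k a); split; first exact: finite_system_single.
    by move=> z; rewrite /laurent_sum fsum_single.
  by rewrite fsum_single.
have [re_int reE] := muP _ _ (Ga 1); have [im_int imE] := muP _ _ (Ga (- 'i)).
have iRe (x : R[i]) : complex.Re (- 'i * x) = complex.Im x.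
  by case: x => a b; rewrite -complexiE; simpc.
have fre : (fun z : Cstar R => complex.Re (1 * monom k z)) =
    fun z => complex.Re (monom k z).
  by apply/funext => z; rewrite mul1r.
have fim : (fun z : Cstar R => complex.Re (- 'i * monom k z)) =
    fun z => complex.Im (monom k z).
  by apply/funext => z; rewrite iRe.
rewrite fre in re_int reE; rewrite fim in im_int imE.
split; first by split.
rewrite /cintegral reE imE mul1r iRe.
by case: (c k).
Qed.
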